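(* Let $n\ge 3$ and $m\ge 2$ be integers. Let $L$ be a complex solvable Leibniz superalgebra such that $L^2=[L,L]$ is nilpotent and the nilradical of $L$ is isomorphic to the Leibniz superalgebra $LP^{n,m}$ defined below, and suppose $\dim L$ is maximal among all complex solvable Leibniz superalgebras with these properties. Then there is a basis $\{x_1,\dots,x_n,t_1,t_2,t_3\}$ of $L_{\bar 0}$ and $\{y_1,\dots,y_m\}$ of $L_{\bar 1}$ in which the only nonzero products of $L$ are $[x_i,x_1]=x_{i+1}$ ($2\le i\le n-1$); $[y_j,x_1]=y_{j+1}$ ($1\le j\le m-1$); $[t_1,x_1]=-x_1$; $[x_1,t_1]=x_1$; $[x_i,t_1]=(i-2)x_i$ ($3\le i\le n$); $[y_j,t_1]=(j-1)y_j$ ($2\le j\le m$); $[x_i,t_2]=x_i$ ($2\le i\le n$); $[y_j,t_3]=y_j$ ($1\le j\le m$). (This superalgebra is denoted $SLP^{n,m}$.)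
   Context: A Leibniz superalgebra is a $\mathbb{Z}_2$-graded complex vector space $L=L_{\bar 0}\oplus L_{\bar 1}$ with an even bilinear product satisfying $[x,[y,z]]=[[x,y],z]-(-1)^{|y||z|}[[x,z],y]$ for all $x$ and homogeneous $y,z$. It is nilpotent if $\mathcal C^0=L$, $\mathcal C^{k+1}=[\mathcal C^k,L]$ reaches $0$, solvable if the derived sequence $\mathcal D^{k+1}=[\mathcal D^k,\mathcal D^k]$ reaches $0$; the nilradical is the maximal nilpotent graded ideal. Isomorphisms preserve the grading. $LP^{n,m}$ has even basis $x_1,\dots,x_n$ and odd basis $y_1,\dots,y_m$ with only nonzero products $[x_i,x_1]=x_{i+1}$ ($2\le i\le n-1$) and $[y_j,x_1]=y_{j+1}$ ($1\le j\le m-1$). *)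

(* Defs.v *)
From HB Require Import structures.
From mathcomp Require Import all_boot all_order all_algebra.
From mathcomp Require Import reals.
From mathcomp Require Export complex.
Set Implicit Arguments. Unset Strict Implicit. Unset Printing Implicit Defensive.
Import Order.TTheory GRing.Theory Num.Theory.
Local Open Scope ring_scope.

Section SuperAlg.
Variable K : fieldType.

(* A finite-dimensional superalgebra: a basis e_0,...,e_{N-1}, each basis
   vector homogeneous of parity [sa_par i] (false = even, true = odd), and the
   product [e_i, e_j] = sa_c i j.  The underlying space is 'rV[K]_N. *)
Record sa := SA {
  sa_dim : nat;
  sa_par : 'I_sa_dim -> bool;
  sa_c : 'I_sa_dim -> 'I_sa_dim -> 'rV[K]_sa_dim }.

Definition V (L : sa) := 'rV[K]_(sa_dim L).

Definition evn (N k : nat) : 'rV[K]_N := \row_(l < N) ((l : nat) == k)%:R.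

Definition mul (L : sa) (u v : V L) : V L :=
  \sum_(i < sa_dim L) \sum_(j < sa_dim L) (u 0 i * v 0 j) *: @sa_c L i j.

Definition part (L : sa) (b : bool) : {vspace V L} :=
  (\sum_(i < sa_dim L | @sa_par L i == b) <[evn (sa_dim L) i]>)%VS.

Definition even_product (L : sa) : Prop :=
  forall i j, @sa_c L i j \in part L (@sa_par L i (+) @sa_par L j).

Definition leibniz_identity (L : sa) : Prop :=
  forall (a b : bool) (x y z : V L), y \in part L a -> z \in part L b ->
    mul x (mul y z) = mul (mul x y) z - (-1) ^+ (a && b) *: mul (mul x z) y.

Definition leibniz_superalgebra (L : sa) : Prop :=
  even_product L /\ leibniz_identity L.

(* [U, W] = span of all products [u, w], u in U, w in W (by bilinearity it is
   spanned by the products of basis vectors) *)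
Definition brk (L : sa) (U W : {vspace V L}) : {vspace V L} :=
  (\sum_(i < \dim U) \sum_(j < \dim W)
     <[mul (tnth (vbasis U) i) (tnth (vbasis W) j)]>)%VS.

Fixpoint lcs (L : sa) (U : {vspace V L}) (k : nat) : {vspace V L} :=
  if k is k'.+1 then brk (lcs U k') U else U.

Fixpoint dser (L : sa) (U : {vspace V L}) (k : nat) : {vspace V L} :=
  if k is k'.+1 then brk (dser U k') (dser U k') else U.

Definition nilpotent_sub (L : sa) (U : {vspace V L}) : Prop :=
  exists k, lcs U k = 0%VS.

Definition solvable (L : sa) : Prop := exists k, dser (fullv : {vspace V L}) k = 0%VS.

Definition graded (L : sa) (U : {vspace V L}) : Prop :=
  U = ((U :&: part L false) + (U :&: part L true))%VS.

Definition ideal (L : sa) (U : {vspace V L}) : Prop :=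
  (brk U fullv <= U)%VS /\ (brk fullv U <= U)%VS.

Definition is_nilradical (L : sa) (U : {vspace V L}) : Prop :=
  [/\ graded U, ideal U, nilpotent_sub U &
      forall W : {vspace V L}, graded W -> ideal W -> nilpotent_sub W ->
        (U <= W)%VS -> W = U].

Definition sa_hom (M L : sa) (f : 'Hom(V M, V L)) : Prop :=
  (forall u v : V M, f (mul u v) = mul (f u) (f v)) /\
  (forall b, (f @: part M b <= part L b)%VS).

Definition iso_onto (M L : sa) (U : {vspace V L}) : Prop :=
  exists f : 'Hom(V M, V L), [/\ sa_hom f, lker f = 0%VS & limg f = U].

Definition sa_iso (L M : sa) : Prop := iso_onto M (fullv : {vspace V L}).

End SuperAlg.

(* ---------- LP^{n,m} ----------
   basis: x_k (1<=k<=n) has index k-1 (even), y_j (1<=j<=m) has index n+j-1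
   (odd).  Nonzero products: [x_i,x_1] = x_{i+1} (2<=i<=n-1),
   [y_j,x_1] = y_{j+1} (1<=j<=m-1). *)
Definition LP_c (K : fieldType) (n m : nat) (i j : nat) : 'rV[K]_(n + m) :=
  if (j == 0)%N && (((1 <= i) && (i <= n - 2)) || ((n <= i) && (i < n + m - 1)))%N
  then evn K (n + m) i.+1 else 0.

Definition LP (K : fieldType) (n m : nat) : sa K :=
  @SA K (n + m) (fun i => (n <= i)%N) (fun i j => LP_c K n m i j).

(* ---------- SLP^{n,m} ----------
   basis: x_k (1<=k<=n) index k-1, t_s (1<=s<=3) index n+s-1 (even),
   y_j (1<=j<=m) index n+3+j-1 (odd).  Nonzero products:
   [x_i,x_1]=x_{i+1} (2<=i<=n-1); [y_j,x_1]=y_{j+1} (1<=j<=m-1);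
   [t_1,x_1]=-x_1; [x_1,t_1]=x_1; [x_i,t_1]=(i-2)x_i (3<=i<=n);
   [y_j,t_1]=(j-1)y_j (2<=j<=m); [x_i,t_2]=x_i (2<=i<=n); [y_j,t_3]=y_j. *)
Definition SLP_c (K : fieldType) (n m : nat) (i j : nat) : 'rV[K]_(n + m + 3) :=
  let e := evn K (n + m + 3) in
  (* [x_{i+1}, x_1] = x_{i+2},  2 <= i+1 <= n-1 *)
  if (j == 0)%N && (1 <= i <= n - 2)%N then e i.+1
  else if (j == 0)%N && (n + 3 <= i)%N && (i < n + m + 2)%N then e i.+1
  else if (i == n)%N && (j == 0)%N then - e 0%N
  else if (i == 0)%N && (j == n)%N then e 0%N
  (* [x_{i+1}, t_1] = (i-1) x_{i+1},  3 <= i+1 <= n *)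
  else if (j == n)%N && (2 <= i <= n - 1)%N then (i - 1)%:R *: e i
  (* [y_l, t_1] = (l-1) y_l  where i = n+3+l-1 *)
  else if (j == n)%N && (n + 3 <= i)%N then (i - (n + 3))%:R *: e i
  (* [x_{i+1}, t_2] = x_{i+1},  2 <= i+1 <= n *)
  else if (j == n + 1)%N && (1 <= i <= n - 1)%N then e i
  else if (j == n + 2)%N && (n + 3 <= i)%N then e i
  else 0.

Definition SLP (K : fieldType) (n m : nat) : sa K :=
  @SA K (n + m + 3) (fun i => (n + 3 <= i)%N) (fun i j => SLP_c K n m i j).

Definition admissible (K : fieldType) (n m : nat) (L : sa K) : Prop :=
  [/\ leibniz_superalgebra L, solvable L,
      nilpotent_sub (brk (fullv : {vspace V L}) fullv) &
      exists U : {vspace V L}, is_nilradical U /\ iso_onto (LP K n m) U].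

(* Main.v *)
(** Write [U] for the nilradical. A Fitting argument on the lower central series
of [U] puts [[L, L]] and the odd part of [L] inside [U], and an even [h] outside
[U] must act non-nilpotently on [U]. An even derivation of [LP] is triangular,
with diagonal determined by its entries [(a, b, c)] at [x_1], [x_2], [y_1]; hence
[h |-> (a, b, c)] is injective on [L_0 / U_0]. Since [SLP] is admissible, maximality
gives [dim L >= n + m + 3], so this map is onto. Some even [t] therefore has
[(a, b, c) = (1, 2, n + 1)], and acts on [U] with the distinct nonzero weights
[1, ..., n + m]. Eigenvectors of [t] provide a new copy of the [LP] basis of [U]; the
even centralizer of [t] is a three-dimensional complement of [U] which acts
diagonally on the right, and the Leibniz identity determines its left action. *)

From Pilot Require Import Defs.
From HB Require Import structures.
From mathcomp Require Import all_boot all_order all_algebra reals complex.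
From mathcomp Require Import zify ring.
(* Again, since MathComp shadows [mul]. *)
Import Pilot.Defs.
Set Implicit Arguments. Unset Strict Implicit. Unset Printing Implicit Defensive.
Import Order.TTheory GRing.Theory Num.Theory.
Local Open Scope ring_scope.

(** * Bilinear algebra and Leibniz superalgebras *)

(** Only right multiplications obey a Leibniz rule, so the triangular form concerns the right action
    of [h] alone, and nothing is known at first about the left action. The weights of [t] give
    access to it: when [[h, t] = 0], both actions of [h] commute with right multiplication by [t],
    and since the weights are distinct, its eigenspaces on [U] are lines, so both actions are
    diagonal. Distinct weights also make the triangular system for eigenvectors solvable. The
    absence of weight 0 makes right multiplication by [t] invertible on [U]: every even [h] can then
    be moved into the centralizer of [t] by subtracting an element of [U], and a product of two
    centralizing elements, being in [U] and of weight 0, must vanish. *)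

Section Superalgebra.
Variables (K : fieldType).

Section Basics.
Variable L : sa K.
Implicit Types (u v w x y z : V L) (A B U W T Z : {vspace V L}).

Lemma evn_sum (k : nat) (v : 'rV[K]_k) : v = \sum_i v 0 i *: evn K k i.
Proof.
apply/rowP => j; rewrite summxE (bigD1 j) //= !mxE eqxx mulr1 big1 ?addr0 //.
by move=> i ne; rewrite !mxE (inj_eq val_inj) eq_sym (negbTE ne) mulr0.
Qed.

Fact mul_linear u : linear (@mul K L u).
Proof.
move=> a v w; rewrite /mul scaler_sumr -big_split; apply: eq_bigr => i _ /=.
rewrite scaler_sumr -big_split; apply: eq_bigr => j _ /=.
by rewrite !mxE scalerA -scalerDl; congr (_ *: _); ring.
Qed.
HB.instance Definition _ u :=
  GRing.isLinear.Build K (V L) (V L) _ (@mul K L u) (mul_linear u).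

Definition rmul v u := mul u v.

Fact rmul_linear v : linear (rmul v).
Proof.
move=> a u w; rewrite /rmul /mul scaler_sumr -big_split; apply: eq_bigr => i _ /=.
rewrite scaler_sumr -big_split; apply: eq_bigr => j _ /=.
by rewrite !mxE scalerA -scalerDl; congr (_ *: _); ring.
Qed.
HB.instance Definition _ v :=
  GRing.isLinear.Build K (V L) (V L) _ (rmul v) (rmul_linear v).

Lemma smulDr u v w : mul u (v + w) = mul u v + mul u w. Proof. exact: linearD. Qed.
Lemma smulDl u v w : mul (u + v) w = mul u w + mul v w.
Proof. exact: (linearD (rmul w)). Qed.
Lemma smulBl u v w : mul (u - v) w = mul u w - mul v w.
Proof. exact: (linearB (rmul w)). Qed.
Lemma smulZr a u v : mul u (a *: v) = a *: mul u v. Proof. exact: linearZ. Qed.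
Lemma smulZl a u v : mul (a *: u) v = a *: mul u v.
Proof. by rewrite -[LHS]/(rmul v _) linearZ. Qed.
Lemma smul0r u : mul u 0 = 0. Proof. exact: linear0. Qed.
Lemma smul0l u : mul 0 u = 0. Proof. exact: (linear0 (rmul u)). Qed.
Lemma smul_sumr u (I : Type) (r : seq I) (P : pred I) (F : I -> V L) :
  mul u (\sum_(i <- r | P i) F i) = \sum_(i <- r | P i) mul u (F i).
Proof. exact: linear_sum. Qed.
Lemma smul_suml u (I : Type) (r : seq I) (P : pred I) (F : I -> V L) :
  mul (\sum_(i <- r | P i) F i) u = \sum_(i <- r | P i) mul (F i) u.
Proof. exact: (linear_sum (rmul u)). Qed.

Lemma mul_evn (i j : 'I_(sa_dim L)) : mul (evn K (sa_dim L) i : V L) (evn K (sa_dim L) j : V L) = sa_c i j.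
Proof.
rewrite /mul (bigD1 i) //= [X in _ + X]big1 ?addr0; last first.
  move=> i' ne; rewrite big1 // => j' _.
  by rewrite !mxE (inj_eq val_inj) (negbTE ne) mul0r scale0r.
rewrite (bigD1 j) //= [X in _ + X]big1 ?addr0; last first.
  move=> j' ne; by rewrite !mxE (inj_eq val_inj j') (negbTE ne) mulr0 scale0r.
by rewrite !mxE !eqxx mulr1 scale1r.
Qed.

Lemma brk_subP U W Z :
  reflect (forall u w, u \in U -> w \in W -> mul u w \in Z) (brk U W <= Z)%VS.
Proof.
apply: (iffP idP) => [sub u w uU wW | H]; last first.
  apply/subv_sumP => i _; apply/subv_sumP => j _.
  by rewrite -memvE; apply: H; apply: vbasis_mem; apply: mem_tnth.
rewrite (coord_vbasis uU) (coord_vbasis wW) smul_suml rpred_sum // => i _.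
rewrite smul_sumr rpred_sum // => j _; rewrite smulZl smulZr !rpredZ //.
rewrite -!tnth_nth; apply: (subvP sub).
rewrite /brk memvE (sumv_sup i) // (sumv_sup j) //.
Qed.

Lemma mem_brk U W u w : u \in U -> w \in W -> mul u w \in brk U W.
Proof. by move: u w; apply/brk_subP. Qed.

Lemma brkS U U' W W' : (U <= U')%VS -> (W <= W')%VS -> (brk U W <= brk U' W')%VS.
Proof.
move=> /subvP s /subvP s'; apply/brk_subP => u w uU wW.
by apply: mem_brk; [apply: s | apply: s'].
Qed.

Lemma brk_ind U W Z z : (forall u w, u \in U -> w \in W -> mul (mul u w) z \in Z) ->
  forall x, x \in brk U W -> mul x z \in Z.
Proof.
move=> H x xB; have sub : (brk U W <= linfun (rmul z) @^-1: Z)%VS.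
  by apply/brk_subP => u w uU wW; rewrite -memv_preim lfunE; apply: H.
by move/subvP: sub => /(_ x xB); rewrite -memv_preim lfunE.
Qed.

Lemma lcsS U W k : (U <= W)%VS -> (lcs U k <= lcs W k)%VS.
Proof. by move=> s; elim: k => //= k IH; apply: brkS. Qed.

(** * Homogeneous components and graded subspaces *)

Definition proj b v : V L := \row_i (if sa_par i == b then v 0 i else 0).

Fact proj_linear b : linear (proj b).
Proof.
by move=> a u v; apply/rowP => i; rewrite !mxE; case: eqP => // _; rewrite mulr0 addr0.
Qed.
HB.instance Definition _ b :=
  GRing.isLinear.Build K (V L) (V L) _ (proj b) (proj_linear b).

Lemma proj_split b v : v = proj b v + proj (~~ b) v.
Proof.
apply/rowP => i; rewrite !mxE; case: (sa_par i) b => [] [] /=;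
  by rewrite ?addr0 ?add0r.
Qed.

Lemma mem_span_evn (k : nat) (P : pred 'I_k) (v : 'rV[K]_k) :
  reflect (forall i, ~~ P i -> v 0 i = 0)
          (v \in (\sum_(i < k | P i) <[evn K k i]>)%VS).
Proof.
apply: (iffP idP) => [/memv_sumP[w wP ->] i nPi | H].
  rewrite summxE big1 // => j Pj; have /vlineP[c ->] := wP j Pj.
  rewrite !mxE (inj_eq val_inj); case: eqP => [E|_]; last by rewrite mulr0.
  by rewrite E Pj in nPi.
rewrite (evn_sum v) (bigID P) /= [X in _ + X]big1 ?addr0; last first.
  by move=> i /H ->; rewrite scale0r.
by apply: memv_sumr => i Pi; rewrite memvZ ?memv_line.
Qed.

Lemma mem_part b v : reflect (forall i, sa_par i != b -> v 0 i = 0) (v \in part L b).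
Proof. exact: mem_span_evn. Qed.

Lemma proj_part b v : proj b v \in part L b.
Proof. by apply/mem_part => i ne; rewrite mxE (negbTE ne). Qed.

Lemma proj_id b v : v \in part L b -> proj b v = v.
Proof.
by move=> /mem_part H; apply/rowP => i; rewrite mxE; case: eqP => // /eqP /H.
Qed.

Lemma proj_neg b v : v \in part L b -> proj (~~ b) v = 0.
Proof.
move=> /mem_part H; apply/rowP => i; rewrite !mxE; case: eqP => // E.
by apply: H; rewrite E; case: (b).
Qed.

Lemma gradedP U : graded U <-> forall b u, u \in U -> proj b u \in U.
Proof.
split=> [gU b u | H].
  rewrite {1}gU => /memv_addP[v]; rewrite memv_cap => /andP[vU v0] [w].
  rewrite memv_cap => /andP[wU w1] ->; rewrite linearD /=.
  case: b.
    by rewrite (proj_neg v0) add0r (proj_id w1).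
  by rewrite (proj_id v0) (proj_neg w1) addr0.
apply/eqP; rewrite eqEsubv subv_add !capvSl !andbT.
apply/subvP => u uU; rewrite (proj_split false u) memv_add //;
  by rewrite memv_cap proj_part H.
Qed.

Lemma graded_add U W : graded U -> graded W -> graded (U + W)%VS.
Proof.
move=> /gradedP gU /gradedP gW; apply/gradedP => b x /memv_addP[u uU [w wW ->]].
by rewrite linearD memv_add ?gU ?gW.
Qed.

Lemma graded_line b t : t \in part L b -> graded <[t]>%VS.
Proof.
move=> tb; apply/gradedP => c u /vlineP[a ->]; rewrite linearZ memvZ //=.
have [<-|ne] := eqVneq b c; first by rewrite proj_id ?memv_line.
have -> : c = ~~ b by case: b c {tb} ne => [] [].
by rewrite proj_neg ?mem0v.
Qed.

Hypothesis leibL : leibniz_superalgebra L.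

Lemma mul_part b c u v : u \in part L b -> v \in part L c -> mul u v \in part L (b (+) c).
Proof.
move=> /mem_part ub /mem_part vc; rewrite /mul rpred_sum // => i _.
rewrite rpred_sum // => j _.
have [Ei|/ub->] := eqVneq (sa_par i) b; last by rewrite mul0r scale0r mem0v.
have [Ej|/vc->] := eqVneq (sa_par j) c; last by rewrite mulr0 scale0r mem0v.
by rewrite memvZ // -Ei -Ej leibL.1.
Qed.

Lemma graded_brk U W : graded U -> graded W -> graded (brk U W).
Proof.
move=> /gradedP gU /gradedP gW; apply/gradedP => b x xB.
suff sub : (brk U W <= linfun (proj b) @^-1: (brk U W))%VS.
  by move/subvP: sub => /(_ x xB); rewrite -memv_preim lfunE.
apply/brk_subP => u w uU wW; rewrite -memv_preim lfunE /=.
suff H c d : proj b (mul (proj c u) (proj d w)) \in brk U W.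
  rewrite (proj_split false u) (proj_split false w) smulDl !smulDr !linearD /=.
  by rewrite !memvD ?H.
have m := mul_part (proj_part c u) (proj_part d w).
have [<-|ne] := eqVneq (c (+) d) b.
  by rewrite proj_id //; apply: mem_brk; [apply: gU|apply: gW].
have -> : b = ~~ (c (+) d) by case: (c (+) d) b ne {m} => [] [].
by rewrite proj_neg // mem0v.
Qed.

Lemma leibniz a b x y z : y \in part L a -> z \in part L b ->
  mul x (mul y z) = mul (mul x y) z - (-1) ^+ (a && b) *: mul (mul x z) y.
Proof. exact: leibL.2. Qed.

Lemma leibniz_even x y z b : y \in part L b -> z \in part L false ->
  mul x (mul y z) = mul (mul x y) z - mul (mul x z) y.
Proof. by move=> yb z0; rewrite (leibniz x yb z0) andbF expr0 scale1r. Qed.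

Lemma graded_full : graded (fullv : {vspace V L}).
Proof. by apply/gradedP => b u _; rewrite memvf. Qed.

(** * Nilpotency of the sum of a nilpotent ideal and a subspace *)

Section IdealSum.
Variables (U T : {vspace V L}).
Hypotheses (gU : graded U) (iU : ideal U).

Lemma lcs_sub k : (lcs U k.+1 <= lcs U k)%VS.
Proof.
elim: k => [|k IH] /=; last exact: brkS.
apply: subv_trans (iU.1); by apply: brkS; rewrite ?subvf.
Qed.

(** For homogeneous [w], [z], the product [(u w) z] equals [u (w z)] plus or minus [(u z) w]. The
    first term is a bracket with [w z] in [U], and the second is handled by induction on [u z].
    Gradedness of [U] keeps the components of [w] inside [U]. *)
Lemma lcs_ideal k : (brk (lcs U k) fullv <= lcs U k)%VS.
Proof.
elim: k => [|k IH] /=; first exact: iU.1.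
apply/brk_subP => x z xB _.
move: x xB; apply: brk_ind => u w uU wU.
suff H b c : mul (mul u (proj b w)) (proj c z) \in brk (lcs U k) U.
  rewrite (proj_split false z) smulDr (proj_split false w) !smulDr !smulDl.
  by rewrite !memvD ?H.
have wb : proj b w \in U by move/gradedP: gU; apply.
have -> : mul (mul u (proj b w)) (proj c z) = mul u (mul (proj b w) (proj c z))
   + (-1) ^+ (b && c) *: mul (mul u (proj c z)) (proj b w).
  by rewrite (leibniz u (proj_part b w) (proj_part c z)) subrK.
apply: memvD; first by apply: mem_brk => //; apply: (subvP iU.1); apply: mem_brk => //; rewrite memvf.
by apply: memvZ; apply: mem_brk => //; apply: (subvP IH); apply: mem_brk => //; rewrite memvf.
Qed.

Definition iter_brk Z k := iter k (fun W => brk W T) Z.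

Lemma iter_brkS Z Z' k : (Z <= Z')%VS -> (iter_brk Z k <= iter_brk Z' k)%VS.
Proof. by move=> s; elim: k => //= k IH; apply: brkS. Qed.

(* Modulo the next term of the lower central series of [U], the sum [U + T] acts
   through [T] alone, so the nilpotency of that action lowers the series by one. *)
Lemma nilpotent_add p q : nilpotent_sub U -> iter_brk U p = 0%VS ->
  (lcs (U + T)%VS q <= U)%VS -> nilpotent_sub (U + T)%VS.
Proof.
move=> [r nilU] nilT subq.
suff H k : exists q, (lcs (U + T)%VS q <= lcs U k)%VS.
  have [q'] := H r; rewrite nilU subv0 => /eqP H'; by exists q'.
elim: k => [|k [s IH]]; first by exists q.
have subU : forall j, (lcs U j <= U)%VS.
  by elim=> // j; apply: subv_trans (lcs_sub j).
have it_sub j : (iter_brk (lcs U k) j <= lcs U k)%VS.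
  elim: j => //= j IHj; apply: subv_trans (lcs_ideal k); apply: brkS => //.
  exact: subvf.
suff H j : (lcs (U + T)%VS (j + s) <= iter_brk (lcs U k) j + lcs U k.+1)%VS.
  exists (p + s)%N; apply: subv_trans (H p) _.
  have := iter_brkS p (subU k); rewrite nilT subv0 => /eqP->.
  by rewrite add0v.
elim: j => [|j IHj]; first by rewrite add0n; apply: subv_trans IH (addvSl _ _).
rewrite addSn [lcs _ _]/=; apply: subv_trans (brkS IHj (subvv _)) _.
apply/brk_subP => x y /memv_addP[u uU [v vU ->]] /memv_addP[w wU [t tT ->]].
rewrite smulDl smulDr [X in X + _]addrC -addrA memv_add //.
  by apply: mem_brk.
rewrite memvD //.
  by apply: mem_brk => //; apply: (subvP (it_sub j)).
by apply: (subvP (lcs_ideal k.+1)); apply: mem_brk => //; rewrite memvf.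
Qed.
End IdealSum.
End Basics.
End Superalgebra.

(** * The nilradical *)

Section Nilradical.
Variables (K : numFieldType) (L : sa K) (U : {vspace V L}).
Hypotheses (leibL : leibniz_superalgebra L) (nilU : is_nilradical U).
Hypothesis nil_derived : nilpotent_sub (brk (fullv : {vspace V L}) fullv).
Let D := brk (fullv : {vspace V L}) fullv.

Let gU : graded U. Proof. by case: nilU. Qed.
Let iU : ideal U. Proof. by case: nilU. Qed.
Let nU : nilpotent_sub U. Proof. by case: nilU. Qed.

(** Maximality in [is_nilradical] compares [U] only with ideals containing it, so [T] has to enter
    through [U + T]. *)
Lemma nilradical_max T : graded T -> ideal (U + T)%VS -> nilpotent_sub (U + T)%VS ->
  (T <= U)%VS.
Proof.
case: nilU => _ _ _ maxU gT iT nT.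
by rewrite -[X in (_ <= X)%VS](maxU (U + T)%VS) ?addvSr ?addvSl //; apply: graded_add.
Qed.

Lemma ideal_derived W : (D <= W)%VS -> ideal W.
Proof.
move=> sDW; split; apply: subv_trans sDW; apply: brkS; exact: subvf.
Qed.

Lemma derived_sub_nilradical : (D <= U)%VS.
Proof.
have [q nilD] := nil_derived.
apply: nilradical_max; first by apply: graded_brk => //; apply: graded_full.
- by apply: ideal_derived; apply: addvSr.
(* The first bracket with [D] only leads from [U] into [D]; the following [q] run down the lower
   central series of [D]. *)
apply: (nilpotent_add leibL gU iU (p := q.+1) (q := q)) => //.
  apply/eqP; rewrite -subv0 -nilD.
  elim: q {nilD} => [|q IH] /=; first by apply: brkS; apply: subvf.
  exact: brkS.
suff H k : (lcs (U + D)%VS k <= U + lcs D k)%VS.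
  by apply: subv_trans (H q) _; rewrite nilD addv0.
elim: k => [|k IH] //=; apply: subv_trans (brkS IH (subvv _)) _.
apply/brk_subP => x y /memv_addP[u uU [v vD ->]] /memv_addP[w wU [t tD ->]].
rewrite smulDl (smulDr v) addrA; apply: memv_add; last exact: mem_brk.
rewrite memvD //.
  by apply: (subvP iU.1); apply: mem_brk => //; apply: memvf.
by apply: (subvP iU.2); apply: mem_brk => //; apply: memvf.
Qed.

(** Once [[L, L]] lies in [U], every subspace containing [U] is an ideal and one bracket already
    falls into [U]. So acting nilpotently on [U] is enough for a homogeneous element to belong to
    [U]. *)
Lemma line_sub_nilradical b t p : t \in part L b ->
  iter_brk <[t]>%VS U p = 0%VS -> t \in U.
Proof.
move=> tb nt; rewrite memvE; apply: nilradical_max; first exact: graded_line tb.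
- by apply: ideal_derived; apply: subv_trans derived_sub_nilradical (addvSl _ _).
apply: (nilpotent_add leibL gU iU (p := p) (q := 1)) => //=.
by apply: subv_trans derived_sub_nilradical; apply: brkS; apply: subvf.
Qed.

(* For odd [t], twice the square of right multiplication by [t] is right
   multiplication by [[t, t]], an element of the nilradical. *)
Lemma odd_sub_nilradical : (part L true <= U)%VS.
Proof.
apply/subvP => t t1; have [r nr] := nU.
apply: (line_sub_nilradical (p := r.*2) t1).
apply/eqP; rewrite -subv0 -nr; elim: r {nr} => [|r IH] //=.
apply: subv_trans (brkS (brkS IH (subvv _)) (subvv _)) _.
apply/brk_subP => x y xB /vlineP[c ->]; rewrite smulZr memvZ //.
move: x xB; apply: brk_ind => u w uU /vlineP[d ->].
rewrite smulZr smulZl memvZ //.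
have := leibniz leibL u t1 t1; rewrite /= expr1 scaleN1r opprK => E.
have -> : mul (mul u t) t = 2%:R^-1 *: mul u (mul t t).
  by rewrite E -mulr2n -scaler_nat scalerA mulVf ?scale1r // pnatr_eq0.
apply: memvZ; apply: mem_brk => //; apply: (subvP derived_sub_nilradical).
by apply: mem_brk; apply: memvf.
Qed.
End Nilradical.

(** * Solvable extensions of LP *)

Ltac split_ifs := repeat (case: ifP => ?; try (exfalso; lia)).

Section BasisMaps.
Variables (K : numFieldType) (M L : sa K).
Variable B : nat -> V L.

Definition basis_map (v : V M) : V L := \sum_i v 0 i *: B i.

Fact basis_map_linear : linear basis_map.
Proof.
move=> a u v; rewrite /basis_map scaler_sumr -big_split; apply: eq_bigr => i _ /=.
by rewrite !mxE scalerA -scalerDl.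
Qed.
HB.instance Definition _ :=
  GRing.isLinear.Build K (V M) (V L) _ basis_map basis_map_linear.

Lemma basis_map_evn (k : nat) : (k < sa_dim M)%N ->
  linfun basis_map (evn K (sa_dim M) k) = B k.
Proof.
move=> lk; rewrite lfunE /= /basis_map (bigD1 (Ordinal lk)) //= big1 ?addr0.
  by rewrite mxE eqxx scale1r.
move=> i ne; rewrite mxE; case: eqP => [E|_]; last by rewrite scale0r.
by case/eqP: ne; apply: val_inj.
Qed.

Lemma sa_hom_basis (g : 'Hom(V M, V L)) :
  (forall i j : 'I_(sa_dim M), g (@sa_c K M i j) = mul (g (evn K (sa_dim M) i)) (g (evn K (sa_dim M) j))) ->
  (forall i : 'I_(sa_dim M), g (evn K (sa_dim M) i) \in part L (@sa_par K M i)) -> sa_hom g.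
Proof.
move=> Hm Hp; split=> [u v | b].
  rewrite {2}(evn_sum u) {2}(evn_sum v) {1}/mul !(linear_sum g) smul_suml.
  apply: eq_bigr => i _; rewrite (linear_sum g) smul_sumr; apply: eq_bigr => j _.
  by rewrite !linearZ /= smulZl Hm scalerA mulrC.
apply/subvP => x /memv_imgP[u /mem_part ub ->].
rewrite (evn_sum u) linear_sum rpred_sum // => i _; rewrite linearZ /=.
have [<-|/ub->] := eqVneq (sa_par i) b; first by rewrite memvZ.
by rewrite scale0r mem0v.
Qed.
End BasisMaps.

(** * Even elements acting on a copy of [LP] *)

Section Embedding.
Variables (K : numFieldType) (n m : nat) (L : sa K) (U : {vspace V L}).
Hypotheses (n_ge3 : (3 <= n)%N) (m_ge2 : (2 <= m)%N).
Hypotheses (leibL : leibniz_superalgebra L) (idealU : ideal U).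
Variable f : 'Hom(V (LP K n m), V L).
Hypotheses (homf : sa_hom f) (kerf : lker f = 0%VS) (imf : limg f = U).

(** Indices are plain naturals: [gen k] vanishes from [n + m] on, which keeps shifts such as [k.+1]
    free of bound proofs. *)
Definition gen k : V L := f (evn K (n + m) k).
Local Notation e := gen.
(** This is a coordinate on [U] only; outside [U] the partial inverse of [f] gives an uncontrolled
    linear extension. *)
Definition coef k (v : V L) : K := ((f^-1)%VF v *m (evn K (n + m) k)^T) 0 0.
(** Right multiplication by [x_1] moves along two strings, from [x_2] to [x_n] and from [y_1] to
    [y_m]. These are the indices that are not the end of a string; index 0, that of [x_1], lies on
    neither. *)
Definition has_succ i := ((1 <= i <= n - 2) || (n <= i < n + m - 1))%N.

Lemma succ_lt i : has_succ i -> (i.+1 < n + m)%N.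
Proof. by rewrite /has_succ; lia. Qed.

Fact coef_linear k : linear (coef k : V L -> K^o).
Proof. by move=> a u v; rewrite /coef linearP mulmxDl -scalemxAl !mxE. Qed.
HB.instance Definition _ k :=
  GRing.isLinear.Build K (V L) K^o _ (coef k : V L -> K^o) (coef_linear k).

Lemma coefD k u v : coef k (u + v) = coef k u + coef k v.
Proof. exact: linearD. Qed.
Lemma coefB k u v : coef k (u - v) = coef k u - coef k v.
Proof. exact: linearB. Qed.
Lemma coefZ k a u : coef k (a *: u) = a * coef k u.
Proof. by rewrite linearZ. Qed.
Lemma coef_sum k (I : Type) (r : seq I) (P : pred I) (F : I -> V L) :
  coef k (\sum_(i <- r | P i) F i) = \sum_(i <- r | P i) coef k (F i).
Proof. exact: (linear_sum (coef k : V L -> K^o)). Qed.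
Lemma coef0 k : coef k 0 = 0. Proof. exact: linear0. Qed.

Lemma gen_out k : (n + m <= k)%N -> e k = 0.
Proof.
move=> lk; rewrite /gen (_ : evn _ _ _ = 0) ?linear0 //; apply/rowP => i.
by rewrite !mxE; case: eqP => // E; have: (i < n + m)%N := ltn_ord i; lia.
Qed.

Lemma coef_gen k l : coef k (e l) = ((k == l) && (l < n + m)%N)%:R.
Proof.
rewrite /coef /gen lker0_lfunK ?kerf // mxE.
case: ltnP => lm; rewrite ?andbT ?andbF.
  rewrite (bigD1 (Ordinal lm)) //= !mxE eqxx mul1r eq_sym big1 ?addr0 // => i ne.
  rewrite mxE; case: eqP => [E|_]; last by rewrite mul0r.
  by case/eqP: ne; apply: val_inj.
rewrite big1 // => i _; rewrite !mxE; case: eqP => [E|_]; last by rewrite mul0r.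
by have := ltn_ord i; rewrite E ltnNge lm.
Qed.

Lemma gen_expand u : u \in U -> u = \sum_(i < n + m) coef i u *: e i.
Proof.
rewrite -imf => /memv_imgP[v _ ->]; rewrite {1}(evn_sum v) linear_sum.
apply: eq_bigr => i _; rewrite linearZ /=; congr (_ *: _).
rewrite /coef lker0_lfunK ?kerf // mxE (bigD1 i) //= !mxE eqxx mulr1.
rewrite big1 ?addr0 // => j ne; rewrite !mxE.
by case: eqP => [E|_]; [case/eqP: ne; apply: val_inj | rewrite mulr0].
Qed.

Lemma gen_mem k : e k \in U.
Proof. by rewrite -imf memv_img ?memvf. Qed.

Lemma gen_par k : e k \in part L (n <= k)%N.
Proof.
apply: (subvP (homf.2 _)); apply: memv_img; apply/mem_part => i /= ne.
by rewrite mxE; case: eqP => // E; rewrite E eqxx in ne.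
Qed.

Lemma gen_mul i j : mul (e i) (e j) = if (j == 0%N) && has_succ i then e i.+1 else 0.
Proof.
case: (ltnP i (n + m)) => li; last first.
  rewrite gen_out // smul0l; case: ifP => // /andP[_ s].
  by rewrite /has_succ in s; lia.
case: (ltnP j (n + m)) => lj; last first.
  by rewrite (gen_out lj) smul0r; case: ifP => // /andP[]; lia.
rewrite /gen -homf.1.
have -> : mul (evn K (n + m) i : V (LP K n m)) (evn K (n + m) j : V (LP K n m))
    = LP_c K n m i j by rewrite (mul_evn (L := LP K n m) (Ordinal li) (Ordinal lj)).
rewrite /LP_c -/(has_succ i).
by case: ifP => _; rewrite ?linear0.
Qed.

Lemma gen_mul0 k : mul (e k) (e 0) = if has_succ k then e k.+1 else 0.
Proof. exact: gen_mul. Qed.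

Lemma mul_nil u v : u \in U -> v \in U -> mul u v = coef 0 v *: mul u (e 0).
Proof.
move=> uU vU; have lt0 : (0 < n + m)%N by lia.
rewrite {1}(gen_expand vU) smul_sumr (bigD1 (Ordinal lt0)) //=.
rewrite smulZr big1 ?addr0 // => i ne.
rewrite smulZr (gen_expand uU) smul_suml big1 ?scaler0 // => j _.
rewrite smulZl gen_mul; case: eqP => [E|_]; last by rewrite scaler0.
by case/eqP: ne; apply: val_inj.
Qed.

Lemma mul_gen u k : u \in U -> (0 < k)%N -> mul u (e k) = 0.
Proof.
move=> uU k0; rewrite mul_nil ?gen_mem // coef_gen eq_sym.
by rewrite (gtn_eqF k0) scale0r.
Qed.

(** The upper end [M] is [n] for the even part of the basis and [n + m] for the odd one, so that
    triangularity can be stated within one parity. *)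
Definition flag k M : {vspace V L} := (\sum_(l < n + m | (k <= l < M)%N) <[e l]>)%VS.

Lemma mem_flag k M v :
  v \in flag k M <-> v \in U /\ (forall l, ~~ (k <= l < M)%N -> coef l v = 0).
Proof.
split=> [/memv_sumP[w wP ->] | [vU H]].
  split; first by rewrite rpred_sum // => i /wP /vlineP[c ->]; rewrite memvZ ?gen_mem.
  move=> l nl; rewrite coef_sum big1 // => i Pi.
  have /vlineP[c ->] := wP i Pi; rewrite coefZ coef_gen.
  by case: eqP => [E|_]; [rewrite E Pi in nl | rewrite mulr0].
rewrite (gen_expand vU) (bigID (fun i : 'I_(n + m) => (k <= i < M)%N)) /=.
rewrite [X in _ + X]big1 ?addr0 => [|i /H->]; last by rewrite scale0r.
by apply: memv_sumr => i _; rewrite memvZ ?memv_line.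
Qed.

Lemma flag_sub k M : (flag k M <= U)%VS.
Proof. by apply/subvP => v /mem_flag[]. Qed.

Lemma flagS k M k' M' : (k' <= k)%N -> (M <= M')%N -> (flag k M <= flag k' M')%VS.
Proof.
move=> lk lM; apply/subvP => v /mem_flag[vU H]; apply/mem_flag; split=> // l nl.
by apply: H; lia.
Qed.

Lemma flag_nil k M : (M <= k)%N -> flag k M = 0%VS.
Proof. by move=> le; rewrite /flag big1 // => i; lia. Qed.

Lemma gen_flag k l M : (k <= l < M)%N -> e l \in flag k M.
Proof.
move=> le; apply/mem_flag; split; first exact: gen_mem.
by move=> j nj; rewrite coef_gen; case: eqP => // E; rewrite E le in nj.
Qed.

Lemma flag_ind k M (W : {vspace V L}) (g : {linear V L -> V L}) :
  (forall l, (k <= l < M)%N -> (l < n + m)%N -> g (e l) \in W) ->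
  forall v, v \in flag k M -> g v \in W.
Proof.
move=> H v /memv_sumP[w wP ->]; rewrite linear_sum rpred_sum // => i Pi.
have /vlineP[c ->] := wP i Pi.
by rewrite linearZ memvZ // H ?ltn_ord.
Qed.

Lemma flag_mul0 k M v : (0 < k)%N -> (M == n) || (M == n + m)%N ->
  v \in flag k M -> mul v (e 0) \in flag k.+1 M.
Proof.
move=> k0 HM; apply: (flag_ind (g := rmul (e 0))) => l lM lnm.
rewrite /= /rmul gen_mul0; case: ifP => [s|_]; last exact: mem0v.
case: (ltnP l.+1 (n + m)) => ll; last by rewrite gen_out ?mem0v.
by apply: gen_flag; rewrite /has_succ in s; lia.
Qed.

Lemma flag_par k M b : (forall l, (k <= l < M)%N -> (n <= l)%N = b) ->
  (flag k M <= part L b)%VS.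
Proof.
move=> H; apply/subvP => v vf.
by apply: (flag_ind (g := idfun)) vf => l lM _ /=; rewrite -(H l lM) gen_par.
Qed.

Lemma coef_proj b u l : u \in U ->
  coef l (proj b u) = if (n <= l)%N == b then coef l u else 0.
Proof.
move=> uU; rewrite {1}(gen_expand uU) linear_sum coef_sum /=.
have E i : coef l (proj b (coef i u *: e i)) =
   if (n <= l)%N == b then coef l (coef i u *: e i) else 0.
  rewrite linearZ /= !coefZ.
  have [Eb|ne] := eqVneq (n <= i)%N b.
    rewrite proj_id -?Eb ?gen_par // coef_gen; case: (eqVneq l i) => [->|_] /=.
      by rewrite eqxx.
    by rewrite mulr0; case: ifP.
  have -> : b = ~~ (n <= i)%N by case: (n <= i)%N b ne => [] [].
  rewrite proj_neg ?gen_par // coef0 mulr0 coef_gen; case: (eqVneq l i) => [->|_] /=.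
    by case: (n <= i)%N.
  by rewrite mulr0; case: ifP.
under eq_bigr do rewrite E.
case: ifP => _; last by rewrite big1.
by rewrite -coef_sum -gen_expand.
Qed.

Lemma even_flag u : u \in U -> u \in part L false -> u \in flag 0 n.
Proof.
move=> uU u0; apply/mem_flag; split=> // l nl.
by rewrite -(proj_id u0) coef_proj //; have -> : (n <= l)%N by lia.
Qed.

Lemma odd_flag u : u \in U -> u \in part L true -> u \in flag n (n + m).
Proof.
move=> uU u1; apply/mem_flag; split=> // l nl.
rewrite -(proj_id u1) coef_proj //; case: ifP => // /eqP ln.
by rewrite (gen_expand uU) coef_sum big1 // => i _; rewrite coefZ coef_gen;
  case: eqP => [E|_]; [have := ltn_ord i; lia | rewrite mulr0].
Qed.

Lemma coef_succ v l : v \in U -> has_succ l -> coef l.+1 (mul v (e 0)) = coef l v.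
Proof.
move=> vU sl; have ll : (l < n + m)%N by rewrite /has_succ in sl; lia.
rewrite {1}(gen_expand vU) smul_suml coef_sum (bigD1 (Ordinal ll)) //= big1 ?addr0.
  rewrite smulZl coefZ gen_mul0 sl coef_gen eqxx /=.
  have -> : (l.+1 < n + m)%N by rewrite /has_succ in sl; lia.
  by rewrite mulr1.
move=> i ne; rewrite smulZl coefZ gen_mul0; case: ifP => _; last by rewrite coef0 mulr0.
rewrite coef_gen eqSS; case: eqP => [E|_]; last by rewrite mulr0.
by case/eqP: ne; apply: val_inj.
Qed.

Lemma mul_memU h u : u \in U -> mul u h \in U.
Proof. by move=> uU; apply: (subvP idealU.1); apply: mem_brk => //; apply: memvf. Qed.

Lemma mul_memUl h u : u \in U -> mul h u \in U.
Proof. by move=> uU; apply: (subvP idealU.2); apply: mem_brk => //; apply: memvf. Qed.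

(* The [k]-th diagonal entry of right multiplication by [h] on [U]. *)
Definition lam (k : nat) h : K :=
  if k == 0%N then coef 0 (mul (e 0) h)
  else if (k < n)%N then coef 1 (mul (e 1) h) + k.-1%:R * coef 0 (mul (e 0) h)
  else coef n (mul (e n) h) + (k - n)%:R * coef 0 (mul (e 0) h).

Definition bound k := if (k < n)%N then n else (n + m)%N.

Lemma lamS k h : has_succ k -> lam k.+1 h = lam k h + lam 0 h.
Proof.
rewrite /has_succ /lam => s; have -> : (k == 0)%N = false by lia.
rewrite eqxx /=; case: (ltnP k n) => kn.
  have -> : (k.+1 < n)%N by lia.
  by case: k s kn => [|k] s kn; [lia | rewrite /= -addrA -natr1; ring].
have -> : (k.+1 < n)%N = false by lia.
by rewrite subSn // -natr1; ring.
Qed.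

(** Expanding [[x_1, [x_1, h]]] with [[x_1, x_1] = 0] gives [[[x_1, h], x_1] = 0]. This kills every
    coordinate of [[x_1, h]] that has a successor, and parity leaves only [x_1] and [x_n]. *)
Lemma derivation0 h : h \in part L false ->
  mul (e 0) h - lam 0 h *: e 0 \in flag n.-1 n.
Proof.
move=> h0; have vU := mul_memU h (gen_mem 0).
have v0 : mul (e 0) h \in part L false.
  have := mul_part leibL (gen_par 0) h0; suff -> : (n <= 0)%N = false by []; lia.
have e00 : mul (e 0) (e 0) = 0.
  by rewrite gen_mul0 ifF // /has_succ; lia.
have E : mul (mul (e 0) h) (e 0) = 0.
  have := leibniz_even leibL (e 0) (gen_par 0) h0.
  rewrite mul_nil ?gen_mem // e00 smul0l scaler0 sub0r => /eqP.
  by rewrite eq_sym oppr_eq0 => /eqP.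
have /mem_flag[_ H] := even_flag vU v0.
apply/mem_flag; split; first by rewrite memvB ?memvZ ?gen_mem.
move=> l nl; rewrite coefB coefZ coef_gen.
have [->|l0] := eqVneq l 0%N.
  by rewrite /lam /= (_ : (0 < n + m)%N) ?mulr1 ?subrr //; lia.
rewrite mulr0 subr0; case: (boolP (has_succ l)) => [s|ns].
  by rewrite -coef_succ // E coef0.
by apply: H; rewrite /has_succ in ns; lia.
Qed.

Lemma derivation_gen h k : h \in part L false -> (0 < k < n + m)%N ->
  mul (e k) h - lam k h *: e k \in flag k.+1 (bound k).
Proof.
move=> h0; elim: k => [|k IH] // /andP[_ lk].
have vU := mul_memU h (gen_mem k.+1).
have [k0|kn0] := eqVneq k 0%N.
  (* Right multiplication by [x_2] vanishes on [U], so [[x_2, [x_2, h]] = 0]. Any [x_1]-component of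
     [[x_2, h]] would produce a multiple of [x_3] there. *)
  subst k; have E : mul (e 1) (mul (e 1) h) = 0.
    rewrite (leibniz_even leibL (e 1) (gen_par 1) h0) gen_mul /= smul0l sub0r.
    by rewrite mul_gen ?oppr0 // mul_memU ?gen_mem.
  have s1 : has_succ 1 by rewrite /has_succ; lia.
  have c0 : coef 0 (mul (e 1) h) = 0.
    have := congr1 (coef 2) E; rewrite mul_nil ?gen_mem // gen_mul0 s1.
    rewrite coefZ coef_gen coef0 eqxx /= (_ : (2 < n + m)%N) ?mulr1 //; lia.
  have v0 : mul (e 1) h \in part L false.
    have := mul_part leibL (gen_par 1) h0; suff -> : (n <= 1)%N = false by []; lia.
  have /mem_flag[_ H] := even_flag vU v0.
  apply/mem_flag; split; first by rewrite memvB ?memvZ ?gen_mem.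
  move=> l nl; rewrite coefB coefZ coef_gen.
  have [->|l1] := eqVneq l 1%N.
    rewrite lk /lam /= (_ : (1 < n)%N) ?mul0r ?addr0 ?mulr1 ?subrr //; lia.
  rewrite mulr0 subr0; case: l l1 nl => [|l] l1 nl //.
  by apply: H; move: nl; rewrite /bound; case: ifP; lia.
(* At [y_1], where the odd string starts, parity alone gives the claim. *)
have [kn|kn] := eqVneq k.+1 n.
  have v1 : mul (e k.+1) h \in part L true.
    have := mul_part leibL (gen_par k.+1) h0; suff -> : (n <= k.+1)%N = true by []; lia.
  have /mem_flag[_ H] := odd_flag vU v1.
  apply/mem_flag; split; first by rewrite memvB ?memvZ ?gen_mem.
  move=> l nl; rewrite coefB coefZ coef_gen.
  have [->|l1] := eqVneq l k.+1.
    by rewrite lk /lam -kn ltnn subnn mul0r addr0 mulr1 subrr.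
  by rewrite mulr0 subr0 H //; move: nl; rewrite /bound kn ltnn; lia.
have s : has_succ k by rewrite /has_succ; lia.
have Ek : e k.+1 = mul (e k) (e 0) by rewrite gen_mul0 s.
have bk : bound k.+1 = bound k.
  by rewrite /bound /has_succ in s *; do 2 case: ifP; lia.
have : (0 < k < n + m)%N by lia.
move=> /IH; set r := mul (e k) h - _ => rF.
(* Inside a string, the rule for [[[e_k, x_1], h]] adds the weight of [x_1] to that of [e_k], and
   the remainder is carried along by [x_1]. *)
have E : mul (e k.+1) h - lam k.+1 h *: e k.+1 = mul r (e 0).
  have := leibniz_even leibL (e k) (gen_par 0) h0.
  rewrite mul_nil ?gen_mem ?mul_memU ?gen_mem // -Ek => /eqP.
  rewrite eq_sym subr_eq => /eqP ->.
  rewrite lamS // {2}/lam eqxx /r smulBl smulZl -Ek scalerDl.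
  by rewrite [X in X - _]addrC [X in _ - X]addrC addrKA.
by rewrite E bk flag_mul0 // /bound; case: ifP; rewrite eqxx ?orbT.
Qed.

Lemma derivation_flag h k : h \in part L false -> (k < n + m)%N ->
  mul (e k) h - lam k h *: e k \in flag k.+1 (bound k).
Proof.
move=> h0; case: (posnP k) => [-> _|k0 lk]; last by apply: derivation_gen => //; lia.
have := derivation0 h0; apply: (subvP (flagS _ _)); first by lia.
by rewrite /bound; case: ifP; lia.
Qed.

Lemma derivation_coef h k : h \in part L false -> (k < n + m)%N ->
  coef k (mul (e k) h) = lam k h.
Proof.
move=> h0 lk; have /mem_flag[_ /(_ k)] := derivation_flag h0 lk.
rewrite coefB coefZ coef_gen eqxx lk mulr1 => H; apply/eqP.
by rewrite -subr_eq0 H // ltnn.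
Qed.

Lemma lamE (k : nat) h : lam k h = if k == 0%N then lam 0 h
  else if (k < n)%N then lam 1 h + k.-1%:R * lam 0 h
  else lam n h + (k - n)%:R * lam 0 h.
Proof.
rewrite /lam eqxx ltnn subnn /= (_ : (1 < n)%N); last by lia.
by rewrite (_ : (n == 0%N) = false) ?mul0r ?addr0 //; lia.
Qed.

Fact lam_linear k : linear (lam k : V L -> K^o).
Proof.
move=> a u v; rewrite /lam; do 2?case: ifP => _;
  by rewrite !smulDr !smulZr !coefD !coefZ /GRing.scale /=; ring.
Qed.
HB.instance Definition _ k :=
  GRing.isLinear.Build K (V L) K^o _ (lam k : V L -> K^o) (lam_linear k).

(** The default value of [nth] supplies the third index: 0, 1, [n] are the positions of [x_1],
    [x_2], [y_1], whose weights determine all the others. *)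
Definition idx (s : nat) : nat := nth n [:: 0; 1]%N s.

Lemma lam_nil s u : u \in U -> lam (idx s) u = 0.
Proof.
move=> uU; have H k : coef k (mul (e k) u) = 0.
  rewrite mul_nil ?gen_mem // gen_mul0; case: ifP => _; rewrite ?scaler0 ?coef0 //.
  by rewrite coefZ coef_gen (ltn_eqF (ltnSn k)) mulr0.
by rewrite /lam !H !mulr0 !addr0; do 2?case: ifP.
Qed.

Hypotheses (nilU : is_nilradical U)
  (nil_derived : nilpotent_sub (brk (fullv : {vspace V L}) fullv)).

(** With zero diagonal, bracketing with [h] raises the lower end of the flag each time, so [n + m]
    brackets annihilate [U]. *)
Lemma torus_inj h : h \in part L false ->
  (forall s, (s < 3)%N -> lam (idx s) h = 0) -> h \in U.
Proof.
move=> h0 lh; apply: (line_sub_nilradical leibL nilU nil_derived (p := n + m) h0).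
have lam0 k : lam k h = 0.
  have [l0 l1 ln] := And3 (lh 0%N isT) (lh 1%N isT) (lh 2%N isT).
  by rewrite lamE l0 l1 ln !mulr0 !addr0; do 2?case: ifP.
apply/eqP; rewrite -subv0 -(flag_nil (leqnn (n + m))).
(* The number of brackets and the lower end of the flag vary together; the upper end stays
   [n + m]. *)
elim: {1 2}(n + m)%N => [|k IH].
  by apply/subvP => u uU; apply/mem_flag; split=> // l nl;
     rewrite (gen_expand uU) coef_sum big1 // => i _; rewrite coefZ coef_gen;
     case: eqP => [E|_]; [have := ltn_ord i; lia | rewrite mulr0].
apply: subv_trans (brkS IH (subvv _)) _.
apply/brk_subP => u x uF /vlineP[c ->]; rewrite smulZr memvZ //.
apply: (flag_ind (g := rmul h)) uF => l lk lnm.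
have := derivation_flag h0 lnm; rewrite lam0 scale0r subr0.
apply: (subvP (flagS _ _)); first by lia.
by rewrite /bound; case: ifP; lia.
Qed.

Lemma dim_nilradical : \dim U = (n + m)%N.
Proof.
have := limg_ker_dim f fullv; rewrite kerf capv0 dimv0 add0n imf dimvf.
by rewrite dim_matrix mul1r.
Qed.

Lemma torus_surj (r : 'rV[K]_3) : (n + m + 3 <= sa_dim L)%N ->
  exists2 h, h \in part L false & forall s : 'I_3, lam (idx s) h = r 0 s.
Proof.
move=> dimL; pose phi (h : V L) : 'rV[K]_3 := \row_s lam (idx s) h.
have phiL : linear phi.
  by move=> a u v; apply/rowP => s; rewrite !mxE linearP.
pose phiM := GRing.isLinear.Build K (V L) 'rV[K]_3 _ phi phiL.
pose phiT : {linear V L -> 'rV[K]_3} := HB.pack phi phiM.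
pose g := linfun phiT; set A := part L false.
have sub : (A :&: lker g <= A :&: U)%VS.
  apply/subvP => h; rewrite !memv_cap => /andP[hA]; rewrite memv_ker lfunE /=.
  move=> /eqP/rowP ph; rewrite hA torus_inj // => s s3.
  by have := ph (Ordinal s3); rewrite !mxE.
have full : (A + U = fullv)%VS.
  apply/eqP; rewrite eqEsubv subvf; apply/subvP => v _.
  rewrite (proj_split false v) memv_add ?proj_part //.
  by apply: (subvP (odd_sub_nilradical leibL nilU nil_derived)); apply: proj_part.
(* Dimension count: the kernel of [g] on [A] lies in [A :&: U], so the image has dimension at least
   that of [L] minus that of [U], which is at least 3. *)
have imA : (g @: A = fullv)%VS.
  apply/eqP; rewrite eqEdim subvf /= dimvf dim_matrix mul1r.
  have := limg_ker_dim g A; have := dimv_sum_cap A U; have := dimvS sub.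
  rewrite full dimvf dim_matrix mul1r dim_nilradical => h1 h2 h3.
  have aux a b c d l k : (a <= b -> l + b = c + k -> a + d = c -> k + 3 <= l -> 2 < d)%N.
    by lia.
  exact: (aux _ _ _ _ _ _ h1 h2 h3 dimL).
have : r \in (g @: A)%VS by rewrite imA memvf.
by case/memv_imgP => h hA ->; exists h => // s; rewrite lfunE /= mxE.
Qed.

(** * An eigenbasis for an element with weights 1, ..., n + m *)

Section Eigenbasis.
Variable t : V L.
Hypotheses (t_even : t \in part L false)
  (lam_t : forall k, (k < n + m)%N -> lam k t = k.+1%:R).

Lemma flag_next k M v : v \in flag k M -> coef k v = 0 -> v \in flag k.+1 M.
Proof.
move=> /mem_flag[vU H] ck; apply/mem_flag; split=> // l nl.
by have [->|lk] := eqVneq l k => //; apply: H; lia.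
Qed.

(** Back substitution in a triangular system. The condition on [bound] makes [flag k M] stable under
    [t], and [j] lies outside the range, so its weight differs from every weight met there. *)
Lemma eigen_lift k M j v : (M <= n + m)%N ->
  (forall l, (k <= l < M)%N -> (bound l <= M)%N) -> ~~ (k <= j < M)%N ->
  mul v t - j.+1%:R *: v \in flag k M ->
  exists2 w, w \in flag k M & mul (v + w) t = j.+1%:R *: (v + w).
Proof.
move=> MN; move E: (M - k)%N => d; elim: d k v E => [|d IH] k v E HM nj rF.
  exists 0; first exact: mem0v.
  move: rF; rewrite flag_nil ?memv0; last by lia.
  by rewrite addr0 subr_eq0 => /eqP.
have kM : (k < M)%N by lia.
have kN : (k < n + m)%N by lia.
set r := mul v t - _ in rF; set c := coef k r.
have jk : (j%:R - k%:R : K) != 0 by rewrite subr_eq0 eqr_nat; lia.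
(* Adding [s *: e k] changes the [k]-th coordinate of the defect by [s * (k - j)]; this value of [s]
   cancels it. *)
pose s := c / (j%:R - k%:R).
have eF : mul (e k) t - j.+1%:R *: e k \in flag k M.
  have := derivation_flag t_even kN; set x := mul _ _ - _ => xF.
  have -> : mul (e k) t - j.+1%:R *: e k = x + (lam k t - j.+1%:R) *: e k.
    by rewrite /x scalerBl addrA subrK.
  rewrite memvD // ?memvZ // ?gen_flag ?leqnn //.
  by apply: (subvP (flagS _ _)) xF => //; apply: HM; lia.
have rE : mul (v + s *: e k) t - j.+1%:R *: (v + s *: e k) =
    r + s *: (mul (e k) t - j.+1%:R *: e k).
  rewrite /r smulDl smulZl scalerDr opprD addrACA; congr (_ + _).
  by rewrite scalerBr !scalerA [s * _]mulrC.
have vF : mul (v + s *: e k) t - j.+1%:R *: (v + s *: e k) \in flag k.+1 M.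
  rewrite rE; apply: flag_next; first by rewrite memvD ?memvZ.
  rewrite coefD coefZ (coefB k (mul (e k) t)) derivation_coef // coefZ coef_gen eqxx kN mulr1 lam_t //.
  by rewrite -/c /s -[k.+1%:R]natr1 -[j.+1%:R]natr1; field.
have d' : (M - k.+1)%N = d by lia.
have HM' l : (k.+1 <= l < M)%N -> (bound l <= M)%N by move=> lk; apply: HM; lia.
have nj' : ~~ (k.+1 <= j < M)%N by lia.
have [w wF Hw] := IH _ _ d' HM' nj' vF.
exists (s *: e k + w); last by rewrite addrA.
rewrite memvD ?memvZ ?gen_flag ?leqnn //.
by apply: (subvP (flagS _ _)) wF.
Qed.

Lemma eigenbasis : exists X : nat -> V L,
  [/\ X 0%N - e 0 \in flag n.-1 n,
      forall k, (k < n + m)%N -> X k - e k \in flag k.+1 (bound k),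
      forall k, (k < n + m)%N -> mul (X k) t = k.+1%:R *: X k &
      forall k, has_succ k -> X k.+1 = mul (X k) (e 0)].
Proof.
have lt0 : (0 < n + m)%N by lia.
have lt1 : (1 < n + m)%N by lia.
have ltn' : (n < n + m)%N by lia.
have b1 : bound 1 = n by rewrite /bound (_ : (1 < n)%N) //; lia.
have bn : bound n = (n + m)%N by rewrite /bound ltnn.
have [||||w0 w0F w0t] := @eigen_lift n.-1 n 0 (e 0); first by lia.
- by move=> l ln; rewrite /bound; case: ifP; lia.
- by lia.
- by rewrite -(lam_t lt0) derivation0.
have [||||w1 w1F w1t] := @eigen_lift 2 n 1 (e 1); first by lia.
- by move=> l ln; rewrite /bound; case: ifP; lia.
- by lia.
- by rewrite -(lam_t lt1) -b1 derivation_flag.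
have [||||wn wnF wnt] := @eigen_lift n.+1 (n + m) n (e n); first by lia.
- by move=> l ln; rewrite /bound; case: ifP; lia.
- by lia.
- by rewrite -(lam_t ltn') -bn derivation_flag.
(* Only the generators [x_1], [x_2], [y_1] are corrected. The rest of each string comes from the
   original [e 0], which acts on [U] exactly as the corrected vector does because their difference
   has no [x_1]-component. *)
pose X k := if k == 0%N then e 0 + w0
  else if (k < n)%N then iter k.-1 (rmul (e 0)) (e 1 + w1)
  else iter (k - n) (rmul (e 0)) (e n + wn).
have XS k : has_succ k -> X k.+1 = mul (X k) (e 0).
  rewrite /has_succ /X => s; have -> : (k == 0%N) = false by lia.
  case: (ltnP k n) => kn.
    have -> : (k.+1 < n)%N by lia.
    by case: k s kn => //; lia.
  have -> : (k.+1 < n)%N = false by lia.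
  by rewrite subSn.
have X0 : X 0%N = e 0 + w0 by [].
have X1 : X 1%N = e 1 + w1 by rewrite /X /= (_ : (1 < n)%N) //; lia.
have Xn : X n = e n + wn.
  by rewrite /X ltnn subnn (_ : (n == 0%N) = false) //; lia.
have ind (P : nat -> Prop) : P 0%N -> P 1%N -> P n ->
    (forall k, has_succ k -> P k -> P k.+1) -> forall k, (k < n + m)%N -> P k.
  move=> P0 P1 Pn PS; elim=> // k IH lk.
  have [->//|k0] := eqVneq k 0%N.
  have [->//|kn] := eqVneq k.+1 n.
  by apply: PS; [rewrite /has_succ; lia | apply: IH; lia].
have XF : forall k, (k < n + m)%N -> X k - e k \in flag k.+1 (bound k).
  apply: ind.
  + rewrite X0 addrC addKr; apply: (subvP (flagS _ _)) w0F; first by lia.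
    by rewrite /bound; case: ifP; lia.
  + by rewrite X1 addrC addKr b1.
  + by rewrite Xn addrC addKr bn.
  move=> k s kF; rewrite XS //; have : mul (X k - e k) (e 0) \in flag k.+2 (bound k).
    by apply: flag_mul0 kF => //; rewrite /bound; case: ifP; rewrite eqxx ?orbT.
  rewrite smulBl gen_mul0 s.
  suff -> : bound k = bound k.+1 by [].
  by move: s; rewrite /bound /has_succ; do 2!case: ifP; lia.
exists X; split=> //.
  by rewrite X0 addrC addKr.
apply: ind; rewrite ?X0 ?X1 ?Xn //.
  move=> k s kt; rewrite XS //.
  have kN : (k < n + m)%N by rewrite /has_succ in s; lia.
  have XU : X k \in U.
    by rewrite -(subrK (e k) (X k)) memvD ?gen_mem // (subvP (flag_sub _ _) _ (XF k kN)).
  (* In [[X_k, [x_1, t]]] only the [x_1]-coefficient of [[x_1, t]] counts, and it is 1. Hence [e 0]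
     raises the weight by exactly one even when it is not itself an eigenvector. *)
  have := leibniz_even leibL (X k) (gen_par 0) t_even.
  rewrite (mul_nil XU) ?mul_memU ?gen_mem // derivation_coef // lam_t // scale1r kt.
  move=> /eqP; rewrite eq_sym subr_eq smulZl => /eqP->.
  by rewrite -[X in X + _]scale1r -scalerDl -[k.+2%:R]natr1 addrC.
Qed.

Lemma eigen_embedding : exists g : 'Hom(V (LP K n m), V L),
  [/\ sa_hom g, lker g = 0%VS, limg g = U &
      forall k, (k < n + m)%N ->
        mul (g (evn K (n + m) k)) t = k.+1%:R *: g (evn K (n + m) k)].
Proof.
have [X [X0 XF Xt XS]] := eigenbasis.
have XU k : (k < n + m)%N -> X k \in U.
  move=> kN; rewrite -(subrK (e k) (X k)) memvD ?gen_mem //.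
  exact: (subvP (flag_sub _ _) _ (XF k kN)).
have Xpar k : (k < n + m)%N -> X k \in part L (n <= k)%N.
  move=> kN; rewrite -(subrK (e k) (X k)) memvD ?gen_par //.
  apply: (subvP _ _ (XF k kN)); apply: flag_par => l; rewrite /bound.
  by case: (ltnP k n) => H1 H2; lia.
have coefX k l : (k < n + m)%N -> (l <= k)%N -> coef l (X k) = (l == k)%:R.
  move=> kN lk; rewrite -(subrK (e k) (X k)) coefD coef_gen kN andbT.
  by have /mem_flag[_ ->] := XF k kN; rewrite ?add0r //; lia.
have Xmul i j : (i < n + m)%N -> (j < n + m)%N ->
    mul (X i) (X j) = if (j == 0%N) && has_succ i then X i.+1 else 0.
  move=> iN jN; rewrite mul_nil ?XU // coefX // eq_sym.
  case: eqP => _ /=; last by rewrite scale0r.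
  rewrite scale1r; case: ifP => [/XS->//|ns].
  have [i0|i0] := eqVneq i 0%N.
    rewrite i0 in ns *; rewrite -(subrK (e 0) (X 0%N)) smulDl gen_mul0 ns addr0.
    (* The sharper first clause of [eigenbasis] enters here: the correction of [x_1] is a multiple
       of [x_n], which [x_1] kills. *)
    have : mul (X 0%N - e 0) (e 0) \in flag n.-1.+1 n.
      by apply: flag_mul0 X0; rewrite ?eqxx //; lia.
    by rewrite flag_nil ?memv0 => [/eqP|] //; lia.
  rewrite -(subrK (e i) (X i)) smulDl gen_mul0 ns addr0.
  have := XF i iN; rewrite flag_nil ?memv0 => [/eqP->|]; first by rewrite smul0l.
  by move: ns; rewrite /has_succ /bound; case: ifP; lia.
pose g := linfun (basis_map (M := LP K n m) X).
have gE k : (k < n + m)%N -> g (evn K (n + m) k) = X k by exact: (@basis_map_evn _ (LP K n m) L X k).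
have kg : lker g = 0%VS.
  apply/eqP; rewrite -subv0; apply/subvP => v; rewrite memv_ker memv0 => /eqP gv.
  (* The family [X] is unitriangular with respect to [e], so the coordinates of a kernel vector
     vanish one after the other. *)
  suff H : forall k (i : 'I_(n + m)), (i <= k)%N -> v 0 i = 0.
    by apply/eqP/rowP => i; rewrite mxE (H _ _ (leqnn i)).
  elim/ltn_ind => k IH i ik.
  have := congr1 (coef i) gv; rewrite lfunE /= /basis_map coef_sum coef0.
  rewrite (bigD1 i) //= coefZ coefX // eqxx mulr1 big1 ?addr0 // => j ne.
  rewrite coefZ; case: (ltnP j i) => ji.
    by rewrite (IH j _ j) ?mul0r //; apply: leq_trans ik.
  rewrite coefX //; case: eqP => [E|_]; last by rewrite mulr0.
  by case/eqP: ne; apply: val_inj.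
have gU : (limg g <= U)%VS.
  apply/subvP => _ /memv_imgP[v _ ->]; rewrite lfunE /= rpred_sum // => i _.
  by rewrite memvZ ?XU.
exists g; split=> //.
- apply: sa_hom_basis => [i j | i].
    have iN : (i < n + m)%N := ltn_ord i; have jN : (j < n + m)%N := ltn_ord j.
    rewrite [g (evn _ _ i)]gE // [g (evn _ _ j)]gE // Xmul //= /LP_c -/(has_succ i).
    case: ifP => [/andP[_ s]|_]; last by rewrite linear0.
    by rewrite gE // succ_lt.
  have iN : (i < n + m)%N := ltn_ord i.
  by rewrite [g (evn _ _ i)]gE //; apply: Xpar.
- apply/eqP; rewrite eqEdim gU dim_nilradical.
  have := limg_ker_dim g fullv; rewrite kg capv0 dimv0 add0n => ->.
  by rewrite dimvf dim_matrix mul1r leqnn.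
by move=> k kN; rewrite gE // Xt.
Qed.
End Eigenbasis.

(** * The centralizer of [t] and the multiplication table *)

Section Diagonal.
Variable t : V L.
Hypotheses (t_even : t \in part L false)
  (t_diag : forall k, (k < n + m)%N -> mul (e k) t = k.+1%:R *: e k).

Lemma coef_diag v l : v \in U -> coef l (mul v t) = l.+1%:R * coef l v.
Proof.
move=> vU; rewrite {1 2}(gen_expand vU) smul_suml !coef_sum mulr_sumr.
apply: eq_bigr => i _; rewrite smulZl t_diag ?ltn_ord // !coefZ coef_gen.
case: eqP => [->|_]; first by ring.
by rewrite !mulr0.
Qed.

Lemma weight0 v : v \in U -> mul v t = 0 -> v = 0.
Proof.
move=> vU v0; rewrite (gen_expand vU) big1 // => i _.
have := coef_diag i vU; rewrite v0 coef0 => /esym/eqP.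
by rewrite mulf_eq0 pnatr_eq0 /= => /eqP->; rewrite scale0r.
Qed.

Lemma weightS v k : v \in U -> (k < n + m)%N -> mul v t = k.+1%:R *: v ->
  v = coef k v *: e k.
Proof.
move=> vU kN vk; rewrite {1}(gen_expand vU) (bigD1 (Ordinal kN)) //= big1 ?addr0 //.
move=> i ne; have := coef_diag i vU; rewrite vk coefZ => /eqP.
rewrite -subr_eq0 -mulrBl mulf_eq0 subr_eq0 eqr_nat eqSS => /orP[/eqP E|/eqP->].
  by case/eqP: ne; apply: val_inj.
by rewrite scale0r.
Qed.

Section Centralizer.
Variable h : V L.
Hypotheses (h_even : h \in part L false) (h_t : mul h t = 0).

Lemma right_action k : (k < n + m)%N -> mul (e k) h = lam k h *: e k.
Proof.
move=> kN; rewrite -(derivation_coef h_even kN); apply: weightS => //.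
  by rewrite mul_memU ?gen_mem.
have := leibniz_even leibL (e k) h_even t_even.
rewrite h_t smul0r => /esym/eqP; rewrite subr_eq0 => /eqP ->.
by rewrite t_diag // smulZl.
Qed.

Lemma left_action_weight k : (k < n + m)%N ->
  mul h (e k) = coef k (mul h (e k)) *: e k.
Proof.
move=> kN; apply: weightS => //; first by rewrite mul_memUl ?gen_mem.
have := leibniz_even leibL h (gen_par k) t_even.
by rewrite h_t smul0l subr0 t_diag // smulZr.
Qed.

Lemma gen_neq0 k : (k < n + m)%N -> e k != 0.
Proof.
move=> kN; apply/eqP => /(congr1 (coef k)).
by rewrite coef_gen coef0 eqxx kN => /eqP; rewrite oner_eq0.
Qed.

(** The unknown scalar is read off from [[x_2, [h, x_1]]]: its expansion is the weight of [x_2]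
    minus that of [x_3], times [x_3], and these weights differ by that of [x_1]. *)
Lemma left_action0 : mul h (e 0) = - (lam 0 h *: e 0).
Proof.
have lt0 : (0 < n + m)%N by lia.
have lt1 : (1 < n + m)%N by lia.
have lt2 : (2 < n + m)%N by lia.
have s1 : has_succ 1 by rewrite /has_succ; lia.
have := leibniz leibL (e 1) h_even (gen_par 0).
rewrite left_action_weight // smulZr gen_mul0 s1 scale1r right_action //.
rewrite smulZl gen_mul0 s1 right_action // (lamS h s1) scalerDl opprD addrA subrr add0r.
rewrite -scaleNr => /eqP; rewrite -subr_eq0 -scalerBl scaler_eq0 (negbTE (gen_neq0 lt2)).
by rewrite orbF subr_eq0 => /eqP->; rewrite scaleNr.
Qed.

(** If [e_k] has a successor, expanding [[h, [x_1, e_k]] = 0] leaves [[[h, e_k], x_1] = 0], which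
    forces the scalar of [[h, e_k]] to be zero. The end of a string is written as [[e_{k-1}, x_1]],
    and both terms of its expansion vanish. *)
Lemma left_action k : (0 < k < n + m)%N -> mul h (e k) = 0.
Proof.
move=> /andP[k0 kN]; have hU j : mul h (e j) \in U by rewrite mul_memUl ?gen_mem.
have succ0 j : (0 < j)%N -> has_succ j -> mul h (e j) = 0.
  move=> j0 sj; have jN : (j < n + m)%N by rewrite ltnW ?succ_lt.
  have := leibniz leibL h (gen_par 0) (gen_par j).
  rewrite gen_mul (gtn_eqF j0) /= smul0r mul_gen // sub0r.
  rewrite left_action_weight // smulZl gen_mul0 sj => /esym/eqP.
  rewrite oppr_eq0 scaler_eq0 signr_eq0 /= scaler_eq0 (negbTE (gen_neq0 (succ_lt sj))).
  by rewrite orbF => /eqP->; rewrite scale0r.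
case: (boolP (has_succ k)) => [|ns]; first exact: succ0.
have k1 : (1 < k)%N by rewrite /has_succ in ns; lia.
have sk : has_succ k.-1 by rewrite /has_succ in ns *; lia.
have -> : e k = mul (e k.-1) (e 0) by rewrite gen_mul0 sk prednK.
have := leibniz leibL h (gen_par k.-1) (gen_par 0) => ->.
have k10 : (0 < k.-1)%N by rewrite -subn1 subn_gt0.
by rewrite succ0 // smul0l mul_gen ?hU // scaler0 subr0.
Qed.

Lemma centralizer_abelian h' : h' \in part L false -> mul h' t = 0 -> mul h h' = 0.
Proof.
move=> h'_even h'_t; apply: weight0.
  apply: (subvP (derived_sub_nilradical leibL nilU nil_derived)).
  by apply: mem_brk; apply: memvf.
have := leibniz_even leibL h h'_even t_even.
by rewrite h'_t h_t smul0r smul0l subr0.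
Qed.
End Centralizer.

Lemma torus_lift (r : 'rV[K]_3) : (n + m + 3 <= sa_dim L)%N ->
  exists h, [/\ h \in part L false, mul h t = 0 &
                forall s : 'I_3, lam (idx s) h = r 0 s].
Proof.
move=> dimL; have [h h0 hr] := torus_surj r dimL.
have htU : mul h t \in U.
  apply: (subvP (derived_sub_nilradical leibL nilU nil_derived)).
  by apply: mem_brk; apply: memvf.
have ht0 : mul h t \in part L false := mul_part leibL h0 t_even.
have uF := even_flag htU ht0.
(* Dividing by the weights inverts right multiplication by [t], so [[w, t] = [h, t]]. Since [w] is
   in [U], subtracting it leaves the three weights unchanged. *)
pose w := \sum_(i < n + m | (i < n)%N) (coef i (mul h t) / i.+1%:R) *: e i.
have wU : w \in U by rewrite rpred_sum // => i _; rewrite memvZ ?gen_mem.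
have w0 : w \in part L false.
  rewrite rpred_sum // => i lin; rewrite memvZ //.
  by have := gen_par i; rewrite leqNgt lin.
exists (h - w); split.
- by rewrite memvB.
- rewrite smulBl; apply/eqP; rewrite subr_eq0; apply/eqP.
  rewrite {1}(gen_expand htU) smul_suml (bigID (fun i : 'I_(n + m) => (i < n)%N)) /=.
  rewrite [X in _ + X]big1 ?addr0 => [|i ni].
    apply: eq_bigr => i _; rewrite smulZl t_diag ?ltn_ord // scalerA divfK //.
    by rewrite pnatr_eq0.
  by have /mem_flag[_ ->] := uF; rewrite ?scale0r //.
by move=> s; rewrite linearB /= hr lam_nil // subr0.
Qed.

Lemma torus_basis : (n + m + 3 <= sa_dim L)%N -> exists T : nat -> V L,
  forall s, (s < 3)%N -> [/\ T s \in part L false, mul (T s) t = 0 &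
     forall s', (s' < 3)%N -> lam (idx s') (T s) = (s' == s)%:R].
Proof.
move=> dimL; have H s := torus_lift (evn K 3 s) dimL.
have [h0 [p0 w0 l0]] := H 0%N; have [h1 [p1 w1 l1]] := H 1%N.
have [h2 [p2 w2 l2]] := H 2%N.
exists (nth 0 [:: h0; h1; h2]) => -[|[|[|//]]] _ /=; split=> // s' s'3.
- by rewrite (l0 (Ordinal s'3)) mxE.
- by rewrite (l1 (Ordinal s'3)) mxE.
- by rewrite (l2 (Ordinal s'3)) mxE.
Qed.

Lemma diagonal_iso : (n + m + 3 <= sa_dim L)%N -> sa_iso L (SLP K n m).
Proof.
move=> dimL; have [T TP] := torus_basis dimL.
(* [SLP] lists its torus between the [x]'s and the [y]'s, hence the shift by 3 for the odd
   vectors. *)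
pose B i := if (i < n)%N then e i else if (i < n + 3)%N then T (i - n)%N else e (i - 3)%N.
have BX i : (i < n)%N -> B i = e i by rewrite /B => ->.
have BT s : (s < 3)%N -> B (n + s)%N = T s.
  by move=> s3; rewrite /B ltnNge leq_addr /= ltn_add2l s3 addKn.
have BY j : B (n + 3 + j)%N = e (n + j)%N.
  rewrite /B !ifF; try lia.
  by congr (e _); lia.
have lamT s k : (s < 3)%N -> lam k (T s) = if k == 0%N then (s == 0%N)%:R
   else if (k < n)%N then (s == 1%N)%:R + k.-1%:R * (s == 0%N)%:R
   else (s == 2)%:R + (k - n)%:R * (s == 0%N)%:R.
  move=> s3; have [_ _ lT] := TP s s3; rewrite lamE.
  have := lT 0%N isT; have := lT 1%N isT; have := lT 2%N isT.
  by rewrite /idx /= => -> -> ->; rewrite !(eq_sym s).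
have eT k s : (k < n + m)%N -> (s < 3)%N -> mul (e k) (T s) = lam k (T s) *: e k.
  by move=> kN s3; have [? ? _] := TP s s3; apply: right_action.
have Te0 s : (s < 3)%N -> mul (T s) (e 0) = - (lam 0 (T s) *: e 0).
  by move=> s3; have [? ? _] := TP s s3; apply: left_action0.
have TeS k s : (0 < k < n + m)%N -> (s < 3)%N -> mul (T s) (e k) = 0.
  by move=> kN s3; have [? ? _] := TP s s3; apply: left_action.
have TT s s' : (s < 3)%N -> (s' < 3)%N -> mul (T s) (T s') = 0.
  move=> s3 s3'; have [? ? _] := TP s s3; have [? ? _] := TP s' s3'.
  exact: centralizer_abelian.
pose g := linfun (basis_map (M := SLP K n m) B).
have gE k : (k < n + m + 3)%N -> g (evn K (n + m + 3) k) = B k.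
  exact: (@basis_map_evn _ (SLP K n m) L B k).
have region i : (i < n + m + 3)%N -> [\/ (i < n)%N, exists2 s, (s < 3)%N & i = (n + s)%N |
    exists2 j, (j < m)%N & i = (n + 3 + j)%N].
  move=> iN; case: (ltnP i n) => H1; first by constructor 1.
  case: (ltnP i (n + 3)) => H2.
    by constructor 2; exists (i - n)%N; lia.
  by constructor 3; exists (i - (n + 3))%N; lia.
have gmul i j : (i < n + m + 3)%N -> (j < n + m + 3)%N ->
    g (SLP_c K n m i j) = mul (B i) (B j).
  move=> iN jN; have [jn|[s s3 Ej]|[l lm Ej]] := region j jN.
  - have [in_|[s' s'3 Ei]|[l' l'm Ei]] := region i iN.
    + rewrite !BX // gen_mul /SLP_c /has_succ.
      split_ifs; rewrite ?linear0 //.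
      by rewrite gE ?BX //; lia.
    + rewrite Ei BT // BX //.
      case: (posnP j) => [j0|j0].
        rewrite j0 Te0 // lamT //= /SLP_c.
        split_ifs; rewrite ?linear0 ?linearN /=.
          rewrite gE ?BX //; try lia.
          by rewrite (_ : (s' == 0)%N) ?scale1r //; lia.
        by rewrite (_ : (s' == 0%N) = false) ?scale0r ?oppr0 //; lia.
      rewrite TeS //; last by lia.
      by rewrite /SLP_c; split_ifs; rewrite linear0.
    + rewrite Ei BY BX // gen_mul /SLP_c /has_succ.
      split_ifs; rewrite ?linear0 //.
      rewrite -[(n + 3 + l').+1]addnS -[(n + l').+1]addnS gE; first exact: BY.
      by lia.
  - have [in_|[s' s'3 Ei]|[l' l'm Ei]] := region i iN.
    + rewrite Ej BT // BX // eT //; last by lia.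
      rewrite lamT // in_ /SLP_c.
      case: s s3 {Ej jN} => [|[|[|//]]] _ /=; split_ifs;
        rewrite ?linear0 ?linearZ /= ?gE ?BX //; try lia;
        rewrite ?mulr0 ?mulr1 ?addr0 ?add0r ?scale0r ?scale1r //.
      * by have -> : i = 0%N by lia.
      * by rewrite subn1.
      * by rewrite (_ : i.-1 = 0)%N ?scale0r //; lia.
    + rewrite Ei Ej !BT // TT // /SLP_c.
      by split_ifs; rewrite ?linear0.
    + rewrite Ei Ej BT // BY eT //; last by lia.
      rewrite lamT // /SLP_c.
      case: s s3 {Ej jN} => [|[|[|//]]] _ /=; split_ifs;
        rewrite ?linear0 ?linearZ /= ?gE ?BY //; try lia;
        rewrite ?mulr0 ?mulr1 ?addr0 ?add0r ?scale0r ?scale1r ?addKn //.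
  - have -> : mul (B i) (B j) = 0.
      have l0 : (0 < n + l)%N by lia.
      rewrite Ej BY; have [in_|[s' s'3 Ei]|[l' l'm Ei]] := region i iN.
      + by rewrite BX // mul_gen ?gen_mem.
      + by rewrite Ei BT // TeS //; lia.
      + by rewrite Ei BY mul_gen ?gen_mem.
    by rewrite /SLP_c; split_ifs; rewrite linear0.
have gpar i : (i < n + m + 3)%N -> B i \in part L (n + 3 <= i)%N.
  move=> iN; have [in_|[s s3 Ei]|[l lm Ei]] := region i iN.
  - by rewrite BX //; have := gen_par i; congr (_ \in part L _); lia.
  - rewrite Ei BT //; have [p _ _] := TP s s3.
    by rewrite (_ : (n + 3 <= n + s)%N = false) //; lia.
  - by rewrite Ei BY; have := gen_par (n + l); congr (_ \in part L _); lia.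
have lamB s (i : 'I_(n + m + 3)) : (s < 3)%N ->
    lam (idx s) (B i) = (i == (n + s)%N :> nat)%:R.
  move=> s3; have [in_|[s' s'3 Ei]|[l lm Ei]] := region i (ltn_ord i).
  - by rewrite BX // lam_nil ?gen_mem // ltn_eqF //; lia.
  - by rewrite Ei BT //; have [_ _ ->] := TP s' s'3; rewrite // eqn_add2l eq_sym.
  - by rewrite Ei BY // lam_nil ?gen_mem // gtn_eqF //; lia.
exists g; split.
- apply: sa_hom_basis => [i j | i].
    have iN : (i < n + m + 3)%N := ltn_ord i; have jN : (j < n + m + 3)%N := ltn_ord j.
    by rewrite [g (evn _ _ i)]gE // [g (evn _ _ j)]gE // -gmul.
  have iN : (i < n + m + 3)%N := ltn_ord i.
  by rewrite [g (evn _ _ i)]gE //; apply: gpar.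
- apply/eqP; rewrite -subv0; apply/subvP => v; rewrite memv_ker memv0 => /eqP.
  rewrite lfunE /= /basis_map => gv.
  (* The torus coordinates go first, since [coef] is meaningful only on [U]. The functionals
     [lam (idx s)] vanish on [U] and are dual to the [T s]. *)
  have vT s (i : 'I_(n + m + 3)) : (s < 3)%N -> i = (n + s)%N :> nat -> v 0 i = 0.
    move=> s3 Ei; have := congr1 (lam (idx s)) gv.
    rewrite !linear_sum linear0 (bigD1 i) //= linearZ /= lamB // Ei eqxx big1 => [|j ne].
      by rewrite addr0 /GRing.scale /= mulr1.
    rewrite linearZ /= lamB //; case: eqP => [E|_]; last by rewrite scaler0.
    by case/eqP: ne; apply: val_inj; exact: etrans E (esym Ei).
  pose pos j := if (j < n)%N then j else (j - 3)%N.
  have Bpos j : ~~ (n <= j < n + 3)%N -> B j = e (pos j).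
    by rewrite /B /pos => nj; split_ifs.
  apply/eqP/rowP => i; rewrite mxE.
  case: (boolP (n <= i < n + 3)%N) => [it|ni].
    by apply: (vT (i - n)%N); lia.
  have iN : (i < n + m + 3)%N := ltn_ord i.
  have pN : (pos i < n + m)%N by rewrite /pos; case: ifP; lia.
  have := congr1 (coef (pos i)) gv; rewrite coef_sum coef0 (bigD1 i) //= coefZ.
  rewrite Bpos // coef_gen eqxx pN mulr1 big1 ?addr0 // => j ne.
  case: (boolP (n <= j < n + 3)%N) => [jt|nj].
    by rewrite (vT (j - n)%N) ?scale0r ?coef0 //; lia.
  rewrite coefZ Bpos // coef_gen; case: eqP => [E|_]; last by rewrite mulr0.
  case/eqP: ne; apply: val_inj; move: E ni nj; rewrite /pos /=.
  by case: ifP; case: ifP; lia.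
apply/eqP; rewrite eqEsubv subvf; apply/subvP => v _.
have sUg : (U <= limg g)%VS.
  apply/subvP => u uU; rewrite (gen_expand uU) rpred_sum // => k _; rewrite memvZ //.
  have kN := ltn_ord k; case: (ltnP k n) => kn.
    by rewrite -BX // -gE ?memv_img ?memvf //; lia.
  have -> : e k = B (n + 3 + (k - n))%N by rewrite BY subnKC.
  by rewrite -gE ?memv_img ?memvf //; lia.
have Tg s : (s < 3)%N -> T s \in limg g.
  by move=> s3; rewrite -BT // -gE ?memv_img ?memvf //; lia.
rewrite (proj_split false v) memvD //; last first.
  apply: (subvP sUg); apply: (subvP (odd_sub_nilradical leibL nilU nil_derived)).
  exact: proj_part.
(* Removing from the even part the torus element of the same weights leaves zero weights, hence an
   element of [U] by [torus_inj]. *)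
set h := proj false v; pose w := \sum_(s < 3) lam (idx s) h *: T s.
rewrite -(subrK w h) memvD //; last first.
  by rewrite rpred_sum // => s _; rewrite memvZ ?Tg.
apply: (subvP sUg); apply: torus_inj => [|s s3].
  rewrite memvB ?proj_part // rpred_sum // => s _; rewrite memvZ //.
  by have [] := TP s (ltn_ord s).
rewrite linearB /= linear_sum (bigD1 (Ordinal s3)) //= linearZ /= big1 ?addr0.
  by have [_ _ ->] := TP s s3; rewrite // eqxx /GRing.scale /= mulr1 subrr.
move=> s' ne; rewrite linearZ /=; have [_ _ ->] := TP s' (ltn_ord s'); rewrite //.
case: eqP => [E|_]; last by rewrite scaler0.
by case/eqP: ne; apply: val_inj.
Qed.
End Diagonal.

End Embedding.

(** * Admissibility of SLP *)

Lemma solvable_nil_derived (K : fieldType) (L : sa K) :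
  nilpotent_sub (brk (fullv : {vspace V L}) fullv) -> solvable L.
Proof.
move=> [k nk]; exists k.+1; apply/eqP; rewrite -subv0 -nk.
elim: k {nk} => [|k IH] //; rewrite [dser _ _]/= [lcs _ _]/=.
by apply: brkS => //; apply: brkS; apply: subvf.
Qed.

(** The identity compares operators of right multiplication, so only [y] and [z] are reduced to
    basis vectors; [x] stays arbitrary and may be any product later. *)
Lemma leibniz_basis (K : fieldType) (L : sa K) (e := evn K (sa_dim L)) :
  (forall (x : V L) (j k : 'I_(sa_dim L)), mul x (mul (e j : V L) (e k)) =
     mul (mul x (e j)) (e k) -
     (-1) ^+ (sa_par j && sa_par k) *: mul (mul x (e k)) (e j)) ->
  leibniz_identity L.
Proof.
move=> H a b x y z /mem_part ya /mem_part zb.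
have Hz (j : 'I_(sa_dim L)) : sa_par j = a -> mul x (mul (e j : V L) z) =
    mul (mul x (e j)) z - (-1) ^+ (a && b) *: mul (mul x z) (e j).
  move=> ja; rewrite (evn_sum z) (smul_sumr (e j : V L)) !(smul_sumr x).
  rewrite (smul_sumr (mul x (e j))) smul_suml scaler_sumr -sumrB.
  apply: eq_bigr => k _; rewrite !smulZr smulZl.
  have [kb|/zb->] := eqVneq (sa_par k) b; last first.
    by rewrite !scale0r scaler0 subr0.
  by rewrite H ja kb scalerBr !scalerA mulrC.
rewrite (evn_sum y) (smul_suml z) !(smul_sumr x) (smul_sumr (mul x z)) (smul_suml z).
rewrite scaler_sumr -sumrB.
apply: eq_bigr => j _; rewrite !(smulZl, smulZr).
have [ja|/ya->] := eqVneq (sa_par j) a; last by rewrite !scale0r scaler0 subr0.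
by rewrite Hz // scalerBr !scalerA mulrC.
Qed.

Section SLPAdmissible.
Variables (K : numFieldType) (n m : nat).
Hypotheses (n_ge3 : (3 <= n)%N) (m_ge2 : (2 <= m)%N).

Let N := (n + m + 3)%N.
Let M := SLP K n m.
Let E (k : nat) : V M := evn K N k.

Definition slp_succ i := ((1 <= i <= n - 2) || (n + 3 <= i < n + m + 2))%N.
(** Diagonal entries of right multiplication by [t_{s+1}]. Truncated subtraction gives 0 at the
    torus indices [n], [n + 1], [n + 2]. *)
Definition slp_weight s i : nat :=
  match s with
  | 0 => if (i < n)%N then (if i == 0%N then 1 else i - 1)%N else (i - (n + 3))%N
  | 1 => (1 <= i < n)%N
  | _ => (n + 3 <= i)%N
  end.

Lemma slp_mulE i j : (i < N)%N -> (j < N)%N -> mul (E i) (E j) = SLP_c K n m i j.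
Proof. by move=> iN jN; apply: (mul_evn (L := M) (Ordinal iN) (Ordinal jN)). Qed.

Lemma slp_mul0 i : (i < N)%N -> mul (E i) (E 0) =
  if slp_succ i then E i.+1 else if i == n then - E 0 else 0.
Proof.
move=> iN; rewrite slp_mulE //; last by rewrite /N addn3.
rewrite /SLP_c /slp_succ /N in iN *.
by split_ifs.
Qed.

Lemma slp_mulT i s : (i < N)%N -> (s < 3)%N ->
  mul (E i) (E (n + s)) = (slp_weight s i)%:R *: E i.
Proof.
move=> iN s3; rewrite slp_mulE //; last by rewrite /N; lia.
rewrite /SLP_c /N in iN *; case: s s3 => [|[|[|//]]] _ /=; split_ifs;
  rewrite ?scale0r ?scale1r //; try by have -> : i = 0%N by lia.
- by rewrite (_ : (i - 1 = 0)%N) ?scale0r //; lia.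
- by rewrite (_ : (i - (n + 3) = 0)%N) ?scale0r //; lia.
- by rewrite (_ : (1 <= i < n)%N = true) ?scale1r //; lia.
- by rewrite (_ : (1 <= i < n)%N = false) ?scale0r //; lia.
- by rewrite (_ : (n + 3 <= i)%N = true) ?scale1r //; lia.
- by rewrite (_ : (n + 3 <= i)%N = false) ?scale0r //; lia.
Qed.

(** The positions of [x_1] and the three torus elements, the only basis vectors with nonzero right
    multiplication. All are even, so no sign survives in the Leibniz identity. *)
Definition acting j := (j == 0%N) || (n <= j < n + 3)%N.

Lemma slp_mul_id (x : V M) j : (j < N)%N -> ~~ acting j -> mul x (E j) = 0.
Proof.
move=> jN nj; rewrite (evn_sum x) smul_suml big1 // => i _; rewrite smulZl.
have iN : (i < N)%N := ltn_ord i.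
rewrite -/(E i) slp_mulE //.
by rewrite /SLP_c /acting /N in nj iN jN *; split_ifs; rewrite scaler0.
Qed.

Lemma slp_leibniz : leibniz_identity M.
Proof.
apply: leibniz_basis => x j k; have jN : (j < N)%N := ltn_ord j.
have kN : (k < N)%N := ltn_ord k.
rewrite -/(E j) -/(E k).
case: (boolP (acting k)) => [ak|nk]; last first.
  rewrite (slp_mul_id (E j)) // (slp_mul_id x kN nk) (slp_mul_id (mul x _)) //.
  by rewrite smul0l smul0r scaler0 subr0.
have acting_cases i : acting i -> i = 0%N \/ exists2 s, (s < 3)%N & i = (n + s)%N.
  rewrite /acting => /orP[/eqP->|H]; first by left.
  by right; exists (i - n)%N; lia.
case: (boolP (acting j)) => [aj|nj]; last first.
  rewrite (slp_mul_id x jN nj) (slp_mul_id (mul x _)) // smul0l scaler0 subr0.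
  have [->|[s s3 ->]] := acting_cases k ak.
    rewrite slp_mul0 //; case: ifP => s.
      by apply: slp_mul_id; move: s nj; rewrite /slp_succ /acting /N; lia.
    by case: eqP => [jn|_]; rewrite ?smul0r //; rewrite /acting jn in nj; lia.
  by rewrite slp_mulT // smulZr slp_mul_id ?scaler0.
have -> : (sa_par j && sa_par k) = false.
  have acting_even i : acting i -> (n + 3 <= i)%N = false by rewrite /acting; lia.
  by rewrite /= (acting_even j aj).
rewrite expr0 scale1r.
suff H i : (i < N)%N -> mul (E i) (mul (E j) (E k)) =
    mul (mul (E i) (E j)) (E k) - mul (mul (E i) (E k)) (E j).
  have S z : mul x z = \sum_i x 0 i *: mul (E i) z.
    by rewrite [in LHS](evn_sum x) smul_suml; apply: eq_bigr => i _; rewrite smulZl.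
  rewrite (S (mul _ _)) (S (E j)) (S (E k)) (smul_suml (E k)) (smul_suml (E j)) -sumrB.
  apply: eq_bigr => i _.
  by rewrite !smulZl -scalerBr -(H _ (ltn_ord i)).
move=> iN.
have N0 : (0 < N)%N by rewrite /N; lia.
have TT s s' : (s < 3)%N -> (s' < 3)%N -> mul (E (n + s)) (E (n + s')) = 0.
  move=> s3 s'3; rewrite slp_mulT //; last by rewrite /N; lia.
  suff -> : slp_weight s' (n + s) = 0%N by rewrite scale0r.
  by case: s' s'3 => [|[|[|//]]] _ /=; split_ifs; lia.
have XT s : (s < 3)%N -> mul (E 0) (E (n + s)) = (s == 0%N)%:R *: E 0.
  move=> s3; rewrite slp_mulT //; congr (_%:R *: _).
  by case: s s3 => [|[|[|//]]] _ /=; split_ifs; lia.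
have TX s : (s < 3)%N -> mul (E (n + s)) (E 0) = - ((s == 0%N)%:R *: E 0).
  move=> s3; rewrite slp_mul0; last by rewrite /N; lia.
  rewrite /slp_succ; split_ifs.
    by rewrite (_ : s = 0%N) ?scale1r //; lia.
  by rewrite (_ : (s == 0%N) = false) ?scale0r ?oppr0 //; lia.
(* The only nontrivial commutation relation among right multiplications. *)
have comm s : (s < 3)%N -> mul (mul (E i) (E 0)) (E (n + s)) -
    mul (mul (E i) (E (n + s))) (E 0) = (s == 0%N)%:R *: mul (E i) (E 0).
  move=> s3; rewrite (slp_mulT iN s3) smulZl slp_mul0 //.
  case: ifP => si.
    have iS : (i.+1 < N)%N by rewrite /slp_succ /N in si *; lia.
    rewrite slp_mulT // -scalerBl; congr (_ *: _).
    have -> : slp_weight s i.+1 = (slp_weight s i + (s == 0%N))%N.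
      rewrite /slp_succ in si.
      by case: s s3 => [|[|[|//]]] _ /=; split_ifs; lia.
    by rewrite natrD addrC addKr.
  case: eqP => [->|_]; last by rewrite smul0l !scaler0 subr0.
  rewrite -[- E 0]scaleN1r smulZl XT //.
  have -> : slp_weight s n = 0%N.
    by case: s s3 => [|[|[|//]]] _ /=; split_ifs; lia.
  by rewrite scale0r subr0 !scalerA mulrC.
have [->|[s s3 ->]] := acting_cases j aj; have [->|[s' s'3 ->]] := acting_cases k ak.
- rewrite subrr slp_mul0 // /slp_succ; split_ifs; exact: smul0r.
- by rewrite comm // XT // smulZr.
- by rewrite -opprB comm // TX // -scaleN1r smulZr smulZr scaleN1r.
rewrite TT // smul0r !slp_mulT // !smulZl !slp_mulT //.
by rewrite !scalerA mulrC subrr.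
Qed.

Lemma mem_evn (P : pred 'I_N) (k : nat) : (forall i : 'I_N, i = k :> nat -> P i) ->
  evn K N k \in (\sum_(i < N | P i) <[evn K N i]>)%VS.
Proof.
move=> H; apply/mem_span_evn => i nP; rewrite mxE; case: eqP => // /H Pi.
by rewrite Pi in nP.
Qed.

Lemma slp_even : even_product M.
Proof.
move=> i j; rewrite /= /part /SLP_c; have iN : (i < N)%N := ltn_ord i.
have jN : (j < N)%N := ltn_ord j.
move: (i : nat) (j : nat) iN jN => {}i {}j iN jN.
split_ifs; rewrite ?rpredN ?rpredZ ?mem0v // ?memvZ //; apply: mem_evn => k /= ->;
  rewrite /N in iN jN *; apply/eqP; lia.
Qed.

(** * The nilradical of [SLP] *)

Definition slp_level (k i : nat) := (k <= i < n)%N || (n + 3 + k <= i)%N.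

Definition slp_nil k : {vspace V M} := (\sum_(i < N | slp_level k i) <[evn K N i]>)%VS.

Lemma mem_slp_nil k (v : V M) :
  reflect (forall i : 'I_N, ~~ slp_level k i -> v 0 i = 0) (v \in slp_nil k).
Proof. exact: mem_span_evn. Qed.

Lemma slp_nil_E k i : slp_level k i -> E i \in slp_nil k.
Proof. by move=> l; apply: mem_evn => j ->. Qed.

Lemma slp_derived : (brk (fullv : {vspace V M}) fullv <= slp_nil 0)%VS.
Proof.
apply/brk_subP => u v _ _; rewrite /mul rpred_sum // => i _.
rewrite rpred_sum // => j _; rewrite memvZ //=.
have iN : (i < N)%N := ltn_ord i; have jN : (j < N)%N := ltn_ord j.
move: (i : nat) (j : nat) iN jN => {}i {}j iN jN.
rewrite /SLP_c; split_ifs; rewrite ?rpredN ?mem0v // ?memvZ //;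
  apply: slp_nil_E; rewrite /slp_level /N in iN jN *; lia.
Qed.

(** Each bracket shifts both strings by at least one place. The levels only bound the lower central
    series from above: [x_2] is in level 1 but is not a product of nilradical elements. *)
Lemma slp_lcs k : (lcs (slp_nil 0) k <= slp_nil k)%VS.
Proof.
elim: k => [|k IH] //=; apply: subv_trans (brkS IH (subvv _)) _.
apply/brk_subP => u v /mem_slp_nil uk /mem_slp_nil v0.
rewrite /mul rpred_sum // => i _; rewrite rpred_sum // => j _.
case: (boolP (slp_level k i)) => [li|/uk->]; last by rewrite mul0r scale0r mem0v.
case: (boolP (slp_level 0 j)) => [lj|/v0->]; last by rewrite mulr0 scale0r mem0v.
rewrite memvZ //=.
have iN : (i < N)%N := ltn_ord i; have jN : (j < N)%N := ltn_ord j.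
move: (i : nat) (j : nat) iN jN li lj => {}i {}j iN jN.
rewrite /SLP_c {1 2}/slp_level => li lj; split_ifs; rewrite ?mem0v //;
  apply: slp_nil_E; rewrite /slp_level /N in iN jN *; lia.
Qed.

Lemma slp_nil_nilpotent : nilpotent_sub (slp_nil 0).
Proof.
exists N; apply/eqP; rewrite -subv0; apply: subv_trans (slp_lcs N) _.
apply/subvP => v /mem_slp_nil H; rewrite memv0; apply/eqP/rowP => i.
by rewrite mxE H // /slp_level; have := ltn_ord i; rewrite /N /=; lia.
Qed.

Lemma slp_nil_graded : graded (slp_nil 0).
Proof.
apply/gradedP => b u /mem_slp_nil H; apply/mem_slp_nil => i /H ui.
by rewrite mxE ui; case: ifP.
Qed.

Lemma slp_torus_coef (v : V M) (s : 'I_N) (W : {vspace V M}) :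
  (slp_nil 0 <= W)%VS -> nilpotent_sub W -> v \in W -> ~~ slp_level 0 s -> v 0 s = 0.
Proof.
move=> sW [r nW] vW ns.
have idxN s' : (s' < 3)%N -> (n + s' < N)%N by rewrite /N; lia.
pose o s' (H : (s' < 3)%N) : 'I_N := Ordinal (idxN s' H).
pose c s' H := v 0 (o s' H).
pose c0 := c 0%N isT; pose c1 := c 1%N isT; pose c2 := c 2%N isT.
(* A basis vector [E q] killed by [x_1] is an eigenvector of right multiplication by [v]. A nonzero
   eigenvalue would keep [E q] in every term of the lower central series of [W]. *)
have act q : (q < N)%N -> slp_level 0 q -> ~~ slp_succ q ->
    c0 * (slp_weight 0 q)%:R + c1 * (slp_weight 1 q)%:R + c2 * (slp_weight 2 q)%:R = 0.
  move=> qN lq nq; set a := (X in X = 0).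
  have q0 : mul (E q) (E 0) = 0.
    rewrite slp_mul0 // (negbTE nq); case: eqP => // qn.
    by move: lq; rewrite /slp_level qn; lia.
  have Eqv : mul (E q) v = a *: E q.
    have oN s1 s2 H1 H2 : s1 != s2 -> o s1 H1 != o s2 H2.
      by rewrite -val_eqE /= eqn_add2l.
    rewrite (evn_sum v) smul_sumr (bigD1 (o 0%N isT)) //=.
    rewrite (bigD1 (o 1%N isT)) /=; last exact: oN.
    rewrite (bigD1 (o 2%N isT)) /=; last by rewrite !oN.
    rewrite big1 ?addr0 => [|i].
      by rewrite !smulZr !slp_mulT // !scalerA addrA -!scalerDl.
    rewrite -!val_eqE /= => ni; rewrite smulZr -/(E i).
    have iN : (i < N)%N := ltn_ord i.
    have [->|i0] := eqVneq (i : nat) 0%N; first by rewrite q0 scaler0.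
    rewrite slp_mul_id ?scaler0 //.
    by move: (i : nat) ni i0 => k; rewrite /acting; lia.
  apply/eqP; apply: contraT => a0.
  have H k : E q \in lcs W k.
    elim: k => [|k IH]; first by apply: (subvP sW); apply: slp_nil_E.
    have := mem_brk IH vW; rewrite Eqv => /(memvZ a^-1).
    by rewrite scalerA mulVf // scale1r.
  have := H r; rewrite nW memv0 => /eqP /rowP /(_ (Ordinal qN)).
  by rewrite !mxE eqxx => /eqP; rewrite oner_eq0.
(* The test vectors [x_1], [x_n], [y_m] have torus weights [(1, 0, 0)], [(n - 2, 1, 0)],
   [(m - 1, 0, 1)], a triangular system for [c0], [c1], [c2]. *)
have c0_0 : c0 = 0.
  have N0 : (0 < N)%N by rewrite /N; lia.
  have l0 : slp_level 0 0 by rewrite /slp_level; lia.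
  have n0 : ~~ slp_succ 0 by rewrite /slp_succ; lia.
  have := act 0%N N0 l0 n0; rewrite /slp_weight (_ : (0 < n)%N); last by lia.
  by rewrite (_ : (n + 3 <= 0)%N = false) ?mulr0 ?addr0 ?mulr1 //; lia.
have c1_0 : c1 = 0.
  have nN : (n.-1 < N)%N by rewrite /N; lia.
  have l0 : slp_level 0 n.-1 by rewrite /slp_level; lia.
  have n0 : ~~ slp_succ n.-1 by rewrite /slp_succ; lia.
  have := act n.-1 nN l0 n0; rewrite c0_0 mul0r add0r /slp_weight.
  rewrite (_ : (1 <= n.-1 < n)%N); last by lia.
  by rewrite (_ : (n + 3 <= n.-1)%N = false) ?mulr0 ?addr0 ?mulr1 //; lia.
have c2_0 : c2 = 0.
  have nN : (n + m + 2 < N)%N by rewrite /N; lia.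
  have l0 : slp_level 0 (n + m + 2) by rewrite /slp_level; lia.
  have n0 : ~~ slp_succ (n + m + 2) by rewrite /slp_succ; lia.
  have := act (n + m + 2)%N nN l0 n0; rewrite c0_0 c1_0 !mul0r !add0r /slp_weight.
  by rewrite (_ : (n + 3 <= n + m + 2)%N) ?mulr1 //; lia.
have sN := ltn_ord s.
have [s' s'3 Es] : exists2 s', (s' < 3)%N & s = (n + s')%N :> nat.
  by exists (s - n)%N; move: ns sN; rewrite /slp_level /N; lia.
have -> : s = o s' s'3 by apply: val_inj.
case: s' s'3 {Es} => [|[|[|//]]] s'3.
- by rewrite -c0_0 /c0 /c; congr (v 0 _); apply: val_inj.
- by rewrite -c1_0 /c1 /c; congr (v 0 _); apply: val_inj.
- by rewrite -c2_0 /c2 /c; congr (v 0 _); apply: val_inj.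
Qed.

Lemma slp_nilradical : is_nilradical (slp_nil 0).
Proof.
split; [exact: slp_nil_graded | | exact: slp_nil_nilpotent |].
  by apply: ideal_derived; apply: slp_derived.
move=> W gW iW nW sW; apply/eqP; rewrite eqEsubv sW andbT.
by apply/subvP => v vW; apply/mem_slp_nil => s; apply: slp_torus_coef sW nW vW.
Qed.

Lemma slp_nil_iso : iso_onto (LP K n m) (slp_nil 0).
Proof.
pose B k := E (if (k < n)%N then k else k + 3)%N.
have BX i : (i < n)%N -> B i = E i by rewrite /B => ->.
have BY j : B (n + j)%N = E (n + 3 + j).
  by rewrite /B ifF; [congr E; lia | lia].
pose g := linfun (basis_map (M := LP K n m) (L := M) B).
have gE k : (k < n + m)%N -> g (evn K (n + m) k) = B k.
  exact: (@basis_map_evn _ (LP K n m) M B k).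
have region i : (i < n + m)%N -> (i < n)%N \/ exists2 l, (l < m)%N & i = (n + l)%N.
  move=> iN; case: (ltnP i n) => ni; [by left | right; exists (i - n)%N; lia].
have gmul i j : (i < n + m)%N -> (j < n + m)%N -> g (LP_c K n m i j) = mul (B i) (B j).
  move=> iN jN; case: (posnP j) => [->|j0]; last first.
    rewrite /LP_c (gtn_eqF j0) linear0 /B slp_mul_id //.
      by rewrite /N; case: ifP; lia.
    by rewrite /acting; case: ifP; lia.
  rewrite [B 0%N]BX; last by lia.
  have [ni|[l lm ->]] := region i iN.
    rewrite BX // slp_mul0 /N; last by lia.
    rewrite /LP_c /slp_succ; split_ifs; rewrite ?linear0 // gE; last by lia.
    by rewrite BX //; lia.
  rewrite BY slp_mul0 /N; last by lia.
  rewrite /LP_c /slp_succ; split_ifs; rewrite ?linear0 //.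
  by rewrite -addnS gE ?BY ?addnS //; lia.
have Epar k : E k \in part M (n + 3 <= k)%N.
  by apply: mem_evn => j /= ->.
pose pos (k : nat) := (if (k < n)%N then k else k + 3)%N.
have posN (k : 'I_(n + m)) : (pos k < N)%N.
  by have := ltn_ord k; rewrite /pos /N; case: ifP; lia.
have pos_inj k l : pos k = pos l -> k = l by rewrite /pos; do 2!case: ifP; lia.
exists g; split.
- apply: sa_hom_basis => [i j | i].
    have iN : (i < n + m)%N := ltn_ord i; have jN : (j < n + m)%N := ltn_ord j.
    by rewrite [g (evn _ _ i)]gE // [g (evn _ _ j)]gE // -gmul.
  have iN : (i < n + m)%N := ltn_ord i.
  rewrite [g (evn _ _ i)]gE //=.
  move: (i : nat) iN => k kN; have [ni|[l lm ->]] := region k kN.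
    rewrite BX //; suff -> : (n <= k)%N = (n + 3 <= k)%N by []; lia.
  rewrite BY; suff -> : (n <= n + l)%N = (n + 3 <= n + 3 + l)%N by []; lia.
- apply/eqP; rewrite -subv0; apply/subvP => v; rewrite memv_ker memv0 => /eqP gv.
  apply/eqP/rowP => i; rewrite mxE; have := congr1 (fun w : V M => w 0 (Ordinal (posN i))) gv.
  rewrite lfunE /= /basis_map summxE !mxE (bigD1 i) //= !mxE eqxx mulr1 big1 ?addr0 //.
  move=> j ne; rewrite !mxE; case: eqP => [/pos_inj H|_]; last by rewrite mulr0.
  by case/eqP: ne; apply: val_inj.
apply/eqP; rewrite eqEsubv; apply/andP; split; apply/subvP => v.
  move=> /memv_imgP[u _ ->]; rewrite lfunE /= rpred_sum // => i _; rewrite memvZ //.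
  by apply: slp_nil_E; rewrite /slp_level; case: ifP; lia.
move=> /mem_slp_nil H; rewrite (evn_sum v) rpred_sum // => i _.
case: (boolP (slp_level 0 i)) => [li|/H->]; last by rewrite scale0r mem0v.
rewrite memvZ //; have iN : (i < N)%N := ltn_ord i.
move: (i : nat) li iN => {H}{}i; rewrite /slp_level /N => li iN.
case: (ltnP i n) => ni.
  by rewrite -/(E i) -BX // -gE ?memv_img ?memvf //; lia.
have -> : i = (n + 3 + (i - (n + 3)))%N by lia.
by rewrite -/(E _) -BY -gE ?memv_img ?memvf //; lia.
Qed.

Lemma slp_admissible : admissible n m M.
Proof.
have nilD : nilpotent_sub (brk (fullv : {vspace V M}) fullv).
  have [r nr] := slp_nil_nilpotent; exists r; apply/eqP; rewrite -subv0 -nr.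
  exact: lcsS slp_derived.
split=> //; first by split; [exact: slp_even | exact: slp_leibniz].
  exact: solvable_nil_derived.
by exists (slp_nil 0); split; [exact: slp_nilradical | exact: slp_nil_iso].
Qed.
End SLPAdmissible.

Lemma admissible_max_iso (K : numFieldType) (n m : nat) (L : sa K) :
  (3 <= n)%N -> (2 <= m)%N -> admissible n m L ->
  (forall L' : sa K, admissible n m L' -> (sa_dim L' <= sa_dim L)%N) ->
  sa_iso L (SLP K n m).
Proof.
move=> n3 m2 [leibL _ nilD [U [nilU [f [homf kerf imf]]]]] maxL.
have dimL : (n + m + 3 <= sa_dim L)%N by apply: (maxL (SLP K n m)); apply: slp_admissible.
have idU : ideal U by case: nilU.
(* The default of [nth] again gives the third entry. Along a string the weight grows by that of
   [x_1], here 1, so starting at 2 and at [n + 1] makes the weight at index [k] equal to [k + 1]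
   across both strings. *)
pose r : 'rV[K]_3 := \row_s (nth n.+1 [:: 1; 2] s)%N%:R.
have [t t0 tr] := torus_surj n3 m2 leibL idU homf kerf imf nilU nilD r dimL.
have lam_t k : (k < n + m)%N -> lam f k t = k.+1%:R.
  have l0 : lam f 0 t = 1%:R by rewrite (tr ord0) mxE.
  have l1 : lam f 1 t = 2%:R by rewrite (tr (Ordinal (isT : 1 < 3)%N)) mxE.
  have ln : lam f n t = n.+1%:R by rewrite (tr (Ordinal (isT : 2 < 3)%N)) mxE.
  move=> _; rewrite (lamE n3 m2) ln l1 l0; case: eqP => [->//|k0].
  by case: ltnP => kn; rewrite mulr1 -natrD; congr (_%:R); lia.
have [g [homg kerg img tg]] := eigen_embedding n3 m2 leibL idU homf kerf imf t0 lam_t.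
exact: (diagonal_iso n3 m2 leibL idU homg kerg img nilU nilD t0 tg dimL).
Qed.

(* K = C = R[i] for R the real numbers (any realType) *)
Theorem theorem5p1 (R : realType) (n m : nat) (L : sa R[i]) :
  (3 <= n)%N -> (2 <= m)%N ->
  admissible n m L ->
  (forall L' : sa R[i], admissible n m L' -> (sa_dim L' <= sa_dim L)%N) ->
  sa_iso L (SLP R[i] n m).
Proof. exact: admissible_max_iso. Qed.
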